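(* Consider the stochastic differential equation $\mathrm{d}Z_t=f(Z_t)\,\mathrm{d}t+\sigma\,\mathrm{d}W_t$ on $\mathbb{R}^2$ described in the context. There exists a $\theta$-invariant $\mathcal{F}$-measurable set $\widehat\Omega\subset\Omega$ of full probability such that the following statements hold. (i) For all $\omega\in\widehat\Omega$ and $Z\in\mathbb{R}^2$, the stochastic differential equation admits a unique solution $\varphi(\cdot,\omega,Z)$ (defined for all times $t\ge 0$), and $\varphi$ forms a cocycle for a random dynamical system on $(\widehat\Omega,\mathcal{F},\mathbb{P},(\theta_t)_{t\in\mathbb{R}})$. (ii) There exists a random attractor $A\in\mathcal{F}\otimes\mathcal{B}(\mathbb{R}^2)$ of the random dynamical system $(\theta,\varphi)$ such that $\omega\mapsto A(\omega)$ is measurable with respect to $\mathcal{F}_{-\infty}^{0}$.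
   Context: Parameters: $\alpha,\beta,b\in\mathbb{R}$, $a>0$, $\sigma\ge 0$. The drift $f:\mathbb{R}^2\to\mathbb{R}^2$ is, for $Z=(x,y)^\top$, $$f(Z)=\begin{pmatrix}\alpha&-\beta\\ \beta&\alpha\end{pmatrix}Z-(x^2+y^2)\begin{pmatrix}a&-b\\ b&a\end{pmatrix}Z .$$ Probability space: $\Omega=C_0(\mathbb{R},\mathbb{R}^2)$ is the space of continuous $\omega:\mathbb{R}\to\mathbb{R}^2$ with $\omega(0)=0$, with the compact-open topology; $\mathcal{F}=\mathcal{B}(\Omega)$ is its Borel $\sigma$-algebra; $\mathbb{P}$ is the (two-sided) Wiener measure, so that $W_t(\omega):=\omega(t)$ has independent one-dimensional Brownian motions as its two components. The shift is $(\theta_t\omega)(s)=\omega(s+t)-\omega(t)$; $(\theta_t)_{t\in\mathbb{R}}$ is an ergodic $\mathbb{P}$-preserving flow. $\mathcal{F}_{-\infty}^{t}$ denotes the $\sigma$-algebra generated by the increments $\omega(u)-\omega(v)$, $v\le u\le t$. Solution: a continuous function $\varphi(\cdot,\omega,Z):[0,T]\to\mathbb{R}^2$ solves the equation if $\varphi(t,\omega,Z)=Z+\int_0^t f(\varphi(s,\omega,Z))\,\mathrm{d}s+\sigma\,\omega(t)$ for all $t\in[0,T]$. Random dynamical system: $(\theta,\varphi)$ is a random dynamical system if $\varphi:\mathbb{R}_0^+\times\Omega\times\mathbb{R}^2\to\mathbb{R}^2$ is $(\mathcal{B}(\mathbb{R}_0^+)\otimes\mathcal{F}\otimes\mathcal{B}(\mathbb{R}^2),\mathcal{B}(\mathbb{R}^2))$-measurable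 and a cocycle over $\theta$: $\varphi(0,\omega,\cdot)=\mathrm{Id}$ and $\varphi(t+s,\omega,x)=\varphi(t,\theta_s\omega,\varphi(s,\omega,x))$ for all $\omega$, $x\in\mathbb{R}^2$, $t,s\ge 0$ (here with $\Omega$ replaced by $\widehat\Omega$). Random attractor: a random variable $R$ is tempered if $\lim_{t\to\pm\infty}\frac{1}{|t|}\ln^+R(\theta_t\omega)=0$ for almost all $\omega$. A set $D\in\mathcal{F}\otimes\mathcal{B}(\mathbb{R}^2)$, with fibres $D(\omega)=\{x:(\omega,x)\in D\}$, is tempered if there is a tempered random variable $R$ with $D(\omega)\subset B_{R(\omega)}(0)$ for almost all $\omega$, and compact if $D(\omega)$ is compact for almost all $\omega$. Let $\mathcal{D}$ be the set of all compact tempered $D\in\mathcal{F}\otimes\mathcal{B}(\mathbb{R}^2)$. A set $A\in\mathcal{D}$ is a random attractor if (1) $\varphi(t,\omega)A(\omega)=A(\theta_t\omega)$ for all $t\ge 0$ and almost all $\omega$, and (2) for all $D\in\mathcal{D}$, $\lim_{t\to\infty}\operatorname{dist}(\varphi(t,\theta_{-t}\omega)D(\theta_{-t}\omega),A(\omega))=0$ for almost all $\omega$, where $\operatorname{dist}(E,F)=\sup_{x\in E}\inf_{y\in F}\|x-y\|$. *)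

(* Defs.v *)
(* MathComp-Analysis, over an abstract [R : realType]; the plane is [R * R]. *)
From HB Require Import structures.
From mathcomp Require Export all_boot all_order all_algebra.
From mathcomp Require Export all_classical all_reals all_analysis.

Set Implicit Arguments.
Unset Strict Implicit.
Unset Printing Implicit Defensive.

Export Order.TTheory GRing.Theory Num.Theory.
Export numFieldNormedType.Exports.

Global Open Scope classical_set_scope.
Global Open Scope ring_scope.

Section plane.
Context {R : realType}.

(* The library norm on [R * R] is the maximum norm. *)
Definition enorm (z : R * R) : R := Num.sqrt (z.1 ^+ 2 + z.2 ^+ 2).

Definition eball (r : R) : set (R * R) := [set z | enorm z < r].

(* Extended-real valued, so that the infimum over an empty set is [+oo]; the
   supremum is taken in [0, +oo], so that the semi-distance from an empty set
   is [0]. *)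
Definition semi_dist (E F : set (R * R)) : \bar R :=
  ereal_sup (0%E |`
    [set ereal_inf [set (enorm (x - y))%:E | y in F] | x in E]).

Definition lnplus (x : R) : R := Num.max 0 (ln x).

Definition drift (alpha beta a b : R) (z : R * R) : R * R :=
  let: (x, y) := z in
  let r2 := x ^+ 2 + y ^+ 2 in
  (alpha * x - beta * y - r2 * (a * x - b * y),
   beta * x + alpha * y - r2 * (b * x + a * y)).

Definition integral0 (g : R -> R * R) (t : R) : R * R :=
  (\int[lebesgue_measure]_(s in `[0, t]) (g s).1,
   \int[lebesgue_measure]_(s in `[0, t]) (g s).2).

End plane.

Section wiener_space.
Context (R : realType).

Definition C0_set : set {compact-open, R -> (R * R)%type} :=
  [set w | continuous (w : R -> R * R) /\ w 0 = 0].

(* As a [set_type], it carries the topology induced by the compact-open one. *)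
Definition C0 : Type := set_type C0_set.

HB.instance Definition _ := Topological.on C0.

Lemma C0_set0 : C0_set (fun=> 0).
Proof. by split=> // t; exact: cvg_cst. Qed.

HB.instance Definition _ := isPointed.Build C0 (SigSub (mem_set C0_set0)).

Definition Omega : Type := g_sigma_algebraType (@open C0).

HB.instance Definition _ := Measurable.on Omega.

Definition bpath (w : Omega) : R -> R * R := \val (w : C0).

Lemma bpathP (w : Omega) : C0_set (bpath w).
Proof. exact/set_mem/(valP (w : C0)). Qed.

Lemma C0_shift (t : R) (w : Omega) :
  C0_set (fun s => bpath w (s + t) - bpath w t).
Proof.
have [cw _] := bpathP w; split; last by rewrite add0r subrr.
move=> s; apply: cvgB; last exact: cvg_cst.
apply: (@continuous_comp R R (R * R)%type (fun x => x + t)); last exact: cw.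
by apply: cvgD; [exact: cvg_id|exact: cvg_cst].
Qed.

Definition theta (t : R) (w : Omega) : Omega :=
  SigSub (mem_set (C0_shift t w)).

Lemma thetaE t w s : bpath (theta t w) s = bpath w (s + t) - bpath w t.
Proof. by []. Qed.

(* The sigma-algebra generated by the increments up to time [t]. *)
Definition past (t : R) : set (set Omega) :=
  <<s [set E | exists (u v : R) (B : set (R * R)),
        [/\ v <= u, u <= t, measurable B
          & E = [set w | B (bpath w u - bpath w v)]]] >>.

End wiener_space.

Arguments bpath {R} w.
Arguments theta {R} t w.
Arguments past {R} t.

Section wiener_measure.
Context {R : realType} (P : probability (Omega R) R).

(* [normal_prob m s] has standard deviation [s] and is not the Dirac measure
   for [s = 0], whence the strict inequality between the two times. *)
Definition gaussian_increments (B : R -> Omega R -> R) :=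
  forall s t : R, s < t -> forall A : set R, measurable A ->
    P [set w | A (B t w - B s w)] = normal_prob 0 (Num.sqrt (t - s)) A.

Definition independent_increments (B : R -> Omega R -> R) :=
  forall (n : nat) (t : nat -> R),
    {homo t : i j / (i <= j)%N >-> i <= j} ->
    forall A : nat -> set R, (forall i, measurable (A i)) ->
      P (\bigcap_(i in `I_n) [set w | A i (B (t i.+1) w - B (t i) w)]) =
      (\prod_(i < n) P [set w | A i (B (t i.+1) w - B (t i) w)%R])%E.

(* A standard Brownian motion with time set the whole line. *)
Definition brownian_motion (B : R -> Omega R -> R) :=
  [/\ forall t : R, measurable_fun [set: Omega R] (B t),
      forall w, B 0 w = 0 /\ continuous (fun t => B t w),
      gaussian_increments B
    & independent_increments B].

Definition generated_by (B : R -> Omega R -> R) : set (set (Omega R)) :=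
  <<s [set E | exists (t : R) (A : set R), measurable A /\ E = B t @^-1` A] >>.

Definition independent_processes (B1 B2 : R -> Omega R -> R) :=
  forall E1 E2, generated_by B1 E1 -> generated_by B2 E2 ->
    P (E1 `&` E2) = (P E1 * P E2)%E.

Definition wiener_measure :=
  [/\ brownian_motion (fun t w => (bpath w t).1),
      brownian_motion (fun t w => (bpath w t).2)
    & independent_processes (fun t w => (bpath w t).1)
                            (fun t w => (bpath w t).2)].

End wiener_measure.

Section random_dynamics.
Context {R : realType}.

Definition is_solution (f : R * R -> R * R) (sigma : R) (w : Omega R)
    (Z : R * R) (T : R) (phi : R -> R * R) :=
  {within `[0, T], continuous phi} /\
  forall t : R, 0 <= t <= T ->
    phi t = Z + integral0 (f \o phi) t
              + (sigma * (bpath w t).1, sigma * (bpath w t).2).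

(* Since [Oh] is measurable in all uses, measurability on [Oh] is
   measurability for the trace sigma-algebra; the values of [phi] at negative
   times and outside of [Oh] are irrelevant. *)
Definition random_dynamical_system (Oh : set (Omega R))
    (phi : R -> Omega R -> R * R -> R * R) :=
  [/\ measurable_fun (([set t : R | 0 <= t] `*` Oh) `*` [set: R * R])
        (fun p : R * Omega R * (R * R) => phi p.1.1 p.1.2 p.2),
      forall w x, Oh w -> phi 0 w x = x
    & forall w x (t s : R), Oh w -> 0 <= t -> 0 <= s ->
        phi (t + s) w x = phi t (theta s w) (phi s w x)].

Context (P : probability (Omega R) R).

Definition tempered_variable (r : Omega R -> R) :=
  measurable_fun [set: Omega R] r /\
  {ae P, forall w,
    (lnplus (r (theta t w)) / `|t| @[t --> +oo] --> (0 : R)) /\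
    (lnplus (r (theta t w)) / `|t| @[t --> -oo] --> (0 : R))}.

Definition tempered_set (D : set (Omega R * (R * R))) :=
  exists r, tempered_variable r /\
    {ae P, forall w, xsection D w `<=` eball (r w)}.

Definition compact_tempered (D : set (Omega R * (R * R))) :=
  [/\ measurable D, tempered_set D & {ae P, forall w, compact (xsection D w)}].

Definition random_attractor (phi : R -> Omega R -> R * R -> R * R)
    (A : set (Omega R * (R * R))) :=
  [/\ compact_tempered A,
      {ae P, forall w (t : R), 0 <= t ->
        phi t w @` xsection A w = xsection A (theta t w)}
    & forall D, compact_tempered D ->
        {ae P, forall w,
          semi_dist (phi t (theta (- t) w) @` xsection D (theta (- t) w))
                    (xsection A w) @[t --> +oo] --> 0%E}].

(* Measurability of a set-valued map with respect to a sigma-algebra [G], in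
   the usual sense for random closed sets: hitting sets of open sets are in
   [G]. *)
Definition measurable_multifunction (G : set (set (Omega R)))
    (F : Omega R -> set (R * R)) :=
  forall U : set (R * R), open U -> G [set w | F w `&` U !=set0].

End random_dynamics.

(* Main.v *)
Require Import Defs.
From mathcomp Require Import measurable_realfun ring lra.

(** The noise is additive, so for every single path [w] the stochastic
equation is an ordinary one: with [u = sigma w], the function [v = y - u]
satisfies [v' = f (v + u)].  No path has to be discarded, and [Oh] is the
whole path space.

Existence.  The cubic term is truncated to [- min (|z|^2, N) A z], which is
globally Lipschitz ([truncated_drift_lipschitz]), and Picard iteration applies.
Along truncated solutions [|v|^2] grows at most exponentially, with constants
that do not depend on [N] ([growth_energy], [solution_bound]).  On a bounded
time interval all truncated solutions therefore agree for large [N] and solve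
the original equation.  Uniqueness and continuity in the initial point come
from the same Lipschitz constants ([drift_stability]), the cocycle property
from uniqueness.

Attractor.  The cubic damping gives [(|v|^2)' <= - (a / 16) |v|^4 + M], where
[M] is a polynomial in the oscillation of the noise.  Hence [|v|^2] at time [1]
is bounded independently of the starting point ([coming_down_from_infinity]).
The pullback images of the whole plane at times [s >= 1] are thus contained in
a ball whose radius depends only on the path on [[-1, 0]], and these images
decrease in [s].  The attractor [A w] is the intersection of their closures.
Compactness of the ball makes it nonempty and invariant, and makes it attract
the whole plane, for every [w].  The images depend only on increments before
time [0], and by compactness [A w] meets a closed box as soon as all images
come arbitrarily close to it; with rational starting points this is a
countable condition ([attractor_hits_box], [attractor_past]).

Measurability.  Picard iterates are built from integrals of functions that
are continuous in time and measurable in a parameter, and limits preserve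
measurability.  This is carried out over an arbitrary measurable space
([solve_measurable]), which is then instantiated with the Borel sets and with
the past sigma-algebra.

Temperedness is where the probability enters.  Dyadic chaining of Gaussian
tails and the Borel-Cantelli lemma show that almost surely the oscillation of
the path over [[t - 1, t]] is at most linear in [|t|] for large [|t|]
([osc_linear_growth]).  The radius of the absorbing ball then grows at most
polynomially, and its logarithm is negligible with respect to [|t|]. *)

Set Implicit Arguments.
Unset Strict Implicit.
Unset Printing Implicit Defensive.

(** * Primitives of continuous functions and differential inequalities *)

Lemma is_derive_expM (R : realType) (c k : R) (t : R) :
  is_derive t 1 (fun s => c * expR (k * s)) (c * k * expR (k * t)).
Proof. by apply: is_derive_eq; rewrite /GRing.scale/=; ring. Qed.

Lemma continuous_expM (R : realType) (c k : R) :
  continuous (fun s : R => c * expR (k * s)).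
Proof.
move=> t; apply: cvgM; first exact: cvg_cst.
apply: (@continuous_comp _ _ _ (fun t : R => k * t) (@expR R)).
  by apply: cvgM; [exact: cvg_cst|exact: cvg_id].
exact: continuous_expR.
Qed.

Section calculus.
Context {R : realType}.
Implicit Types (u v f g : R -> R) (t T : R).

Definition primitive u t : R := \int[lebesgue_measure]_(s in `[0, t]) u s.

Lemma continuous_integrable u s t : continuous u ->
  lebesgue_measure.-integrable `[s, t] (EFin \o u).
Proof.
move=> cu; apply: continuous_compact_integrable; first exact: segment_compact.
exact: continuous_subspaceT.
Qed.

Lemma primitive_le0 u t : t <= 0 -> primitive u t = 0.
Proof.
rewrite le_eqVlt => /predU1P[->|t0].
  by rewrite /primitive set_itv1 Rintegral_set1.
by rewrite /primitive set_itv_ge ?Rintegral_set0// bnd_simp -ltNge.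
Qed.

Lemma is_derive_primitive u t : continuous u -> 0 < t ->
  is_derive t 1 (primitive u) (u t).
Proof.
move=> cu t0.
have [||||d e] := @continuous_FTC1_closed R u 0 t (t + 1).
- by rewrite ltrDl.
- exact: continuous_integrable.
- by [].
- exact: cu.
apply: DeriveDef; first exact: d.
by rewrite -derive1E.
Qed.

Lemma continuous_primitive u : continuous u -> continuous (primitive u).
Proof.
move=> cu t; have [t0|t0|->] := ltgtP t 0.
- apply: (@cvg_trans _ ((fun=> 0) @ nbhs t)); last first.
    by rewrite primitive_le0 ?ltW//; exact: cvg_cst.
  apply: near_eq_cvg; near=> s; rewrite primitive_le0//.
  by near: s; exact: lt_le_nbhsl.
- apply/differentiable_continuous/derivable1_diffP.
  by have [] := is_derive_primitive cu t0.
- rewrite /continuous_at [primitive u 0]primitive_le0//.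
  exact: (@parameterized_integral_cvg_left R 0 1 u ltr01
    (@continuous_integrable u 0 1 cu)).
Unshelve. all: by end_near.
Qed.

Lemma nonincreasing_of_derive f (df : R -> R) T : 0 <= T -> continuous f ->
  (forall t, 0 < t < T -> is_derive t 1 f (df t)) ->
  (forall t, 0 < t < T -> df t <= 0) -> f T <= f 0.
Proof.
move=> T0 cf dfE df0; apply: (@ler0_derive1_nincr R f 0 T) => //.
- by move=> x; rewrite in_itv/= => /dfE[].
- move=> x; rewrite in_itv/= => xT.
  by have [_ e] := dfE _ xT; rewrite derive1E e df0.
- exact: continuous_subspaceT.
Qed.

(** The function [exp (- k t) f t - c t] is nonincreasing. *)
Lemma gronwall f (df : R -> R) (k c : R) T : 0 <= T -> 0 <= k -> 0 <= c ->
  continuous f ->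
  (forall t, 0 < t < T -> is_derive t 1 f (df t)) ->
  (forall t, 0 < t < T -> df t <= k * f t + c) ->
  f T <= (f 0 + c * T) * expR (k * T).
Proof.
move=> T0 k0 c0 cf dfE dfle.
pose g t := expR (- k * t) * f t - c * t.
pose dg t := expR (- k * t) * (df t - k * f t) - c.
have ce : continuous (fun t : R => expR (- k * t)).
  have -> : (fun t : R => expR (- k * t)) = (fun t => 1 * expR (- k * t)).
    by apply/funext => t; rewrite mul1r.
  exact: continuous_expM.
have := @nonincreasing_of_derive g dg T T0.
have cg : continuous g.
  move=> t; apply: cvgB; first by apply: cvgM; [exact: ce|exact: cf].
  by apply: cvgM; [exact: cvg_cst|exact: cvg_id].
move=> /(_ cg).
have dgE t : 0 < t < T -> is_derive t 1 g (dg t).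
  move=> /dfE h; rewrite /g; apply: is_derive_eq.
  by rewrite /GRing.scale/= /dg; ring.
move=> /(_ dgE).
have dg0 t : 0 < t < T -> dg t <= 0.
  move=> tT; have /andP[t0 _] := tT; rewrite /dg subr_le0.
  have h := dfle _ tT; have := expR_gt0 (- k * t).
  have e1 : expR (- k * t) <= 1.
    by rewrite -expR0 ler_expR mulNr oppr_le0 mulr_ge0// ltW.
  by nra.
move=> /(_ dg0); rewrite /g !mulr0 expR0 mul1r subr0 mulNr expRN lerBlDr => h.
by rewrite -ler_pdivrMr ?expR_gt0// mulrC.
Qed.

(** A comparison of derivatives: it replaces integral inequalities by a
bound [h] whose derivative dominates the difference of the integrands. *)
Lemma primitive_dist_le u v (h dh : R -> R) T : 0 <= T ->
  continuous u -> continuous v -> continuous h ->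
  (forall t, 0 < t < T -> is_derive t 1 h (dh t)) ->
  (forall t, 0 < t < T -> `|u t - v t| <= dh t) ->
  `|primitive u T - primitive v T| <= h T - h 0.
Proof.
move=> T0 cu cv ch dhE le.
have main u' v' : continuous u' -> continuous v' ->
    (forall t, 0 < t < T -> u' t - v' t <= dh t) ->
    primitive u' T - primitive v' T <= h T - h 0.
  move=> cu' cv' le'.
  have := @nonincreasing_of_derive (fun t => primitive u' t - primitive v' t - h t)
    (fun t => u' t - v' t - dh t) T T0.
  have cf : continuous (fun t => primitive u' t - primitive v' t - h t).
    move=> t; apply: cvgB; last exact: ch.
    by apply: cvgB; exact: continuous_primitive.
  move=> /(_ cf).
  have df t : 0 < t < T ->
      is_derive t 1 (fun t => primitive u' t - primitive v' t - h t)
        (u' t - v' t - dh t).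
    move=> tT; have /andP[t0 _] := tT.
    have := is_derive_primitive cu' t0; have := is_derive_primitive cv' t0.
    by have := dhE _ tT => ? ? ?; apply: is_derive_eq.
  move=> /(_ df); rewrite !(@primitive_le0 _ 0)// => H.
  suff : primitive u' T - primitive v' T - h T <= 0 - 0 - h 0 by lra.
  by apply: H => t /le'; lra.
rewrite ler_norml; apply/andP; split; last first.
  by apply: main => // t /le; rewrite ler_norml => /andP[].
rewrite lerNl opprB; apply: main => // t /le.
by rewrite distrC ler_norml => /andP[].
Qed.

End calculus.

(** * Integrals and limits in the plane *)

Section plane_norm.
Context {R : realType}.
Implicit Types (z : R * R) (e : R).

Lemma norm_pair_le z e : (`|z| <= e) = (`|z.1| <= e) && (`|z.2| <= e).
Proof. by rewrite prod_normE ge_max. Qed.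

Lemma norm_pair_lt z e : (`|z| < e) = (`|z.1| < e) && (`|z.2| < e).
Proof. by rewrite prod_normE gt_max. Qed.

Lemma norm_fst z : `|z.1| <= `|z|.
Proof. by rewrite prod_normE le_max lexx. Qed.

Lemma norm_snd z : `|z.2| <= `|z|.
Proof. by rewrite prod_normE le_max lexx orbT. Qed.

Lemma continuous_fst_comp (T : topologicalType) (f : T -> R * R) :
  continuous f -> continuous (fun t => (f t).1).
Proof. by move=> cf t; apply: (cvg_comp _ _ (cf t)); exact: cvg_fst. Qed.

Lemma continuous_snd_comp (T : topologicalType) (f : T -> R * R) :
  continuous f -> continuous (fun t => (f t).2).
Proof. by move=> cf t; apply: (cvg_comp _ _ (cf t)); exact: cvg_snd. Qed.

Lemma continuous_pair (T : topologicalType) (f g : T -> R) :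
  continuous f -> continuous g -> continuous (fun t => (f t, g t)).
Proof. by move=> cf cg t; exact: (cvg_pair (cf t) (cg t)). Qed.

Lemma integral0E (g : R -> R * R) (t : R) :
  integral0 g t = (primitive (fun s => (g s).1) t, primitive (fun s => (g s).2) t).
Proof. by []. Qed.

Lemma continuous_integral0 (g : R -> R * R) :
  continuous g -> continuous (integral0 g).
Proof.
move=> cg; apply: continuous_pair; apply: continuous_primitive.
  exact: continuous_fst_comp.
exact: continuous_snd_comp.
Qed.

Lemma integral0_dist_le (g1 g2 : R -> R * R) (h dh : R -> R) (T : R) : 0 <= T ->
  continuous g1 -> continuous g2 -> continuous h ->
  (forall t, 0 < t < T -> is_derive t 1 h (dh t)) ->
  (forall t, 0 < t < T -> `|g1 t - g2 t| <= dh t) ->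
  `|integral0 g1 T - integral0 g2 T| <= h T - h 0.
Proof.
move=> T0 c1 c2 ch dhE le; rewrite norm_pair_le; apply/andP; split.
  apply: (primitive_dist_le T0 _ _ ch dhE);
    [exact: continuous_fst_comp|exact: continuous_fst_comp|].
  by move=> t /le; apply: le_trans; exact: (norm_fst (g1 t - g2 t)).
apply: (primitive_dist_le T0 _ _ ch dhE);
    [exact: continuous_snd_comp|exact: continuous_snd_comp|].
by move=> t /le; apply: le_trans; exact: (norm_snd (g1 t - g2 t)).
Qed.

End plane_norm.

(** Adding and subtracting twice the next increment bound turns [x] into
a nonincreasing and a nondecreasing sequence, which squeeze the limit. *)
Lemma geometric_cvg (R : realType) (x : nat -> R) (M : R) :
  (forall n, `|x n.+1 - x n| <= M * 2^-1 ^+ n) ->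
  cvgn x /\ forall n, `|limn x - x n| <= 2 * M * 2^-1 ^+ n.
Proof.
move=> dx.
pose e n : R := 2 * M * 2^-1 ^+ n.
have M0 : 0 <= M by have := dx 0%N; rewrite expr0 mulr1; apply: le_trans.
have eS n : e n.+1 = e n - M * 2^-1 ^+ n by rewrite /e exprS; field.
have e0 n : 0 <= e n by rewrite /e mulr_ge0 ?mulr_ge0 ?exprn_ge0.
have nd : nondecreasing_seq (fun n => x n - e n).
  apply/nondecreasing_seqP => n; rewrite eS.
  by have := dx n; rewrite ler_norml => /andP[]; lra.
have ni : nonincreasing_seq (fun n => x n + e n).
  apply/nonincreasing_seqP => n; rewrite eS.
  by have := dx n; rewrite ler_norml => /andP[]; lra.
have cl : cvgn (fun n => x n - e n).
  apply: nondecreasing_is_cvgn => //; exists (x 0%N + e 0%N) => _ [n _ <-].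
  by apply: (le_trans _ (ni _ _ (leq0n n))); have := e0 n; lra.
have cu : cvgn (fun n => x n + e n).
  apply: nonincreasing_is_cvgn => //; exists (x 0%N - e 0%N) => _ [n _ <-].
  by apply: (le_trans (nd _ _ (leq0n n))); have := e0 n; lra.
have ce : e @ \oo --> (0 : R).
  have h : (fun n => 2^-1 ^+ n) @ \oo --> (0 : R).
    by apply: cvg_expr; rewrite ger0_norm//; lra.
  have := cvgM (cvg_cst (2 * M)) h; rewrite mulr0; exact.
have cx : x @ \oo --> limn (fun n => x n - e n).
  have xE : (fun n => (x n - e n) + e n) = x by apply/funext => n; rewrite subrK.
  by have h := cvgD cl ce; rewrite addr0 in h; rewrite -{1}xE; exact: h.
have xl := cvg_lim (@Rhausdorff R) cx.
split; first by apply/cvg_ex; eexists; exact: cx.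
move=> n; rewrite ler_norml -/(e n).
have := nondecreasing_cvgn_le nd cl n.
have := nonincreasing_cvgn_ge ni cu n.
have -> : limn (fun n => x n + e n) = limn x.
  apply: (cvg_lim (@Rhausdorff R)); rewrite xl -[X in _ --> X]addr0; exact: cvgD.
by rewrite -xl /=; lra.
Qed.

Definition pair_lim (R : realType) (x : nat -> R * R) : R * R :=
  (limn (fun n => (x n).1), limn (fun n => (x n).2)).

Lemma geometric_cvg_pair (R : realType) (x : nat -> R * R) (M : R) :
  (forall n, `|x n.+1 - x n| <= M * 2^-1 ^+ n) ->
  forall n, `|pair_lim x - x n| <= 2 * M * 2^-1 ^+ n.
Proof.
move=> dx n; rewrite norm_pair_le; apply/andP; split.
  apply: (@geometric_cvg _ (fun n => (x n).1) M _).2 => k.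
  exact: le_trans (norm_fst (x k.+1 - x k)) (dx k).
apply: (@geometric_cvg _ (fun n => (x n).2) M _).2 => k.
exact: le_trans (norm_snd (x k.+1 - x k)) (dx k).
Qed.

Lemma geometric_le_eps (R : realType) (M e : R) : 0 < e ->
  exists n : nat, M * 2^-1 ^+ n <= e.
Proof.
move=> e0.
have h : (fun n => M * 2^-1 ^+ n) @ \oo --> (0 : R).
  rewrite -(mulr0 M); apply: cvgM; first exact: cvg_cst.
  by apply: cvg_expr; rewrite ger0_norm//; lra.
move/cvgrPdist_le : h => /(_ _ e0)[n _ /(_ n (leqnn n))] /=.
by rewrite sub0r normrN => /(le_trans (ler_norm _)) ?; exists n.
Qed.

Lemma le_geometric (R : realType) (x M : R) :
  (forall n, x <= M * 2^-1 ^+ n) -> x <= 0.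
Proof.
move=> h; apply/ler_addgt0Pl => e e0; rewrite addr0.
by have [n] := @geometric_le_eps _ M _ e0; apply: le_trans.
Qed.

Lemma continuous_of_approx (R : realType) (f : R -> R * R) :
  (forall t e, 0 < e -> exists g : R -> R * R,
     continuous g /\ forall s, s <= t + 1 -> `|f s - g s| <= e) ->
  continuous f.
Proof.
move=> H t; apply/cvgrPdist_le => e e0.
have e3 : 0 < e / 3 by rewrite divr_gt0.
have [g [cg fg]] := H t _ e3.
move/cvgrPdist_le : (cg t) => /(_ _ e3) cgt.
near=> s.
have -> : f t - f s = (f t - g t) + ((g t - g s) + (g s - f s)).
  by rewrite !subrKA.
have st : s <= t + 1 by near: s; apply: lt_le_nbhsl; rewrite ltrDl.
have h1 := fg t; rewrite lerDl ler01 in h1; have {}h1 := h1 isT.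
have h2 := fg s st; rewrite distrC in h2.
have h3 : `|g t - g s| <= e / 3 by near: s.
rewrite (_ : e = e / 3 + (e / 3 + e / 3)); last by field.
apply: (le_trans (ler_normD _ _)); apply: lerD => //.
by apply: (le_trans (ler_normD _ _)); exact: lerD.
Unshelve. all: by end_near.
Qed.

(** * Picard iteration for globally Lipschitz fields *)

Section picard.
Context {R : realType} (G : R -> R * R -> R * R) (L : R).
Hypothesis L0 : 0 < L.
Hypothesis Gc : forall y, continuous y -> continuous (fun s => G s (y s)).
Hypothesis GL : forall s p q, `|G s p - G s q| <= L * `|p - q|.

(** Integrals over [[0, t]] vanish for [t <= 0], so all iterates equal [Z]
there.  They are continuous on the whole line, which avoids one-sided
statements at [0]. *)
Fixpoint picard (Z : R * R) n : R -> R * R :=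
  if n is m.+1 then fun t => Z + integral0 (fun s => G s (picard Z m s)) t
  else fun=> Z.

Lemma continuous_picard Z n : continuous (picard Z n).
Proof.
elim: n => [|n IH] t; first exact: cvg_cst.
apply: cvgD; first exact: cvg_cst.
by apply: continuous_integral0; exact: Gc.
Qed.

Lemma picard_le0 Z n t : t <= 0 -> picard Z n t = Z.
Proof.
by case: n => // n t0 /=; rewrite integral0E !primitive_le0// -[RHS]addr0.
Qed.

(** With the weight [exp (2 L t)] the Picard operator contracts by the factor
[1/2]: the derivative of [exp (2 L t) / 2] absorbs the Lipschitz constant [L].
The iterates thus converge on every bounded interval. *)
Lemma picard_dist Z T : exists M, forall n t, t <= T ->
  `|picard Z n.+1 t - picard Z n t| <= M * 2^-1 ^+ n.
Proof.
have [T0|T0] := leP T 0.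
  exists 0 => n t tT; rewrite !picard_le0 ?(le_trans tT)//.
  by rewrite subrr normr0 mul0r.
have [C C0 hC] : exists2 C, 0 <= C & forall t, 0 <= t <= T ->
    `|picard Z 1 t - picard Z 0 t| <= C.
  have cf : continuous (fun t => `|picard Z 1 t - picard Z 0 t|).
    move=> t; apply: cvg_norm; apply: cvgB; exact: continuous_picard.
  have [c _ hc] := EVT_max (ltW T0) (@continuous_subspaceT _ _ `[0, T] _ cf).
  exists (`|picard Z 1 c - picard Z 0 c|) => //.
have main n t : 0 <= t <= T ->
    `|picard Z n.+1 t - picard Z n t| <= C * 2^-1 ^+ n * expR (2 * L * t).
  elim: n t => [|n IH] t /andP[t0 tT].
    rewrite expr0 mulr1; apply: (le_trans (hC _ _)); first by rewrite t0.
    by rewrite ler_peMr// -expR0 ler_expR !mulr_ge0// ltW.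
  rewrite [X in `|X|](_ : _ = integral0 (fun s => G s (picard Z n.+1 s)) t -
      integral0 (fun s => G s (picard Z n s)) t); last first.
    rewrite [picard Z n.+2]/= [picard Z n.+1 in X in _ - X]/=.
    by rewrite opprD addrACA subrr add0r.
  apply: (@le_trans _ _ (C * 2^-1 ^+ n.+1 * expR (2 * L * t) -
                         C * 2^-1 ^+ n.+1 * expR (2 * L * 0))); last first.
    by rewrite gerBl mulr_ge0 ?expR_ge0// mulr_ge0// exprn_ge0.
  apply: (integral0_dist_le (h := fun s => C * 2^-1 ^+ n.+1 * expR (2 * L * s)) t0
    _ _ _ (fun s _ => is_derive_expM (C * 2^-1 ^+ n.+1) (2 * L) s)).
  - exact/Gc/continuous_picard.
  - exact/Gc/continuous_picard.
  - exact: continuous_expM.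
  - move=> s /andP[s0 st]; apply: (le_trans (GL _ _ _)).
    have sT : 0 <= s <= T by rewrite (ltW s0) (le_trans (ltW st)).
    rewrite (_ : _ * _ * _ = L * (C * 2^-1 ^+ n * expR (2 * L * s))).
      by rewrite ler_pM2l// IH.
    by rewrite exprS; field.
exists (C * expR (2 * L * T)) => n t tT.
have [t0|t0] := leP t 0.
  rewrite !picard_le0// subrr normr0 mulr_ge0 ?exprn_ge0//.
  by rewrite mulr_ge0// expR_ge0.
apply: (le_trans (main _ _ _)); first by rewrite (ltW t0).
rewrite mulrAC ler_wpM2r ?exprn_ge0// ler_wpM2l// ler_expR.
by rewrite ler_pM2l// mulr_gt0.
Qed.

Definition picard_lim Z (t : R) : R * R := pair_lim (fun n => picard Z n t).

Lemma picard_lim_dist Z T : exists M, forall n t, t <= T ->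
  `|picard_lim Z t - picard Z n t| <= M * 2^-1 ^+ n.
Proof.
have [M hM] := picard_dist Z T; exists (2 * M) => n t tT.
by apply: (geometric_cvg_pair (x := fun n => picard Z n t)) => k; exact: hM.
Qed.

Lemma continuous_picard_lim Z : continuous (picard_lim Z).
Proof.
apply: continuous_of_approx => t e e0.
have [M hM] := picard_lim_dist Z (t + 1).
have [n hn] := geometric_le_eps M e0.
exists (picard Z n); split; first exact: continuous_picard.
by move=> s st; apply: (le_trans (hM n s st)).
Qed.

Lemma picard_limE Z t :
  picard_lim Z t = Z + integral0 (fun s => G s (picard_lim Z s)) t.
Proof.
have [M hM] := picard_lim_dist Z t.
have [t0|t0] := leP t 0.
  rewrite integral0E !primitive_le0// (_ : (0, 0) = 0)// addr0.
  apply/eqP; rewrite -subr_eq0 -normr_le0; apply: (@le_geometric _ _ M) => n.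
  by rewrite -(picard_le0 Z n t0) {1}(picard_le0 _ _ t0) hM.
apply/eqP; rewrite -subr_eq0 -normr_le0.
apply: (@le_geometric _ _ (M + L * M * t)) => n.
rewrite -(subrK (picard Z n.+1 t) (picard_lim Z t)) -addrA.
have M0 : 0 <= M.
  by have := hM 0%N t (lexx _); rewrite expr0 mulr1; apply: le_trans.
rewrite mulrDl; apply: (le_trans (ler_normD _ _)); apply: lerD.
  apply: (le_trans (hM _ _ (lexx _))).
  by rewrite ler_wpM2l// exprS ler_piMl// ?exprn_ge0//; lra.
rewrite [picard Z n.+1]/= opprD addrACA subrr add0r.
pose h s : R := L * M * 2^-1 ^+ n * s.
have -> : L * M * t * 2^-1 ^+ n = h t - h 0 by rewrite /h; ring.
apply: (integral0_dist_le (dh := fun=> L * M * 2^-1 ^+ n) (ltW t0)).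
- exact/Gc/continuous_picard.
- exact/Gc/continuous_picard_lim.
- by move=> s; apply: cvgM; [exact: cvg_cst|exact: cvg_id].
- by move=> s _; rewrite /h; apply: is_derive_eq; rewrite /GRing.scale/=; ring.
- move=> s /andP[s0 st]; apply: (le_trans (GL _ _ _)).
  by rewrite -mulrA ler_pM2l// distrC hM// ltW.
Qed.

End picard.

(** * Energy estimates for the drift *)

Section truncated_drift.
Context {R : realType}.
Variables (alpha beta a b : R).
Hypothesis a_gt0 : 0 < a.
Implicit Types (p q u z : R * R) (m N : R).

Definition sqnorm z : R := z.1 ^+ 2 + z.2 ^+ 2.

(** The drift with its cubic factor [|z|^2] replaced by a free number [m], so
that one energy computation covers the drift and all its truncations. *)
Definition damped m z : R * R :=
  (alpha * z.1 - beta * z.2 - m * (a * z.1 - b * z.2),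
   beta * z.1 + alpha * z.2 - m * (b * z.1 + a * z.2)).

Definition truncated_drift N z : R * R := damped (Num.min (sqnorm z) N) z.

Lemma driftE z : drift alpha beta a b z = damped (sqnorm z) z.
Proof. by case: z. Qed.

Lemma truncated_driftE N z : sqnorm z <= N ->
  truncated_drift N z = drift alpha beta a b z.
Proof. by move=> zN; rewrite driftE /truncated_drift min_l. Qed.

Lemma sqnorm_ge0 z : 0 <= sqnorm z.
Proof. by rewrite addr_ge0// sqr_ge0. Qed.

Lemma sqnorm_le_norm z : sqnorm z <= 2 * `|z| ^+ 2.
Proof.
have h1 := norm_fst z; have h2 := norm_snd z.
rewrite /sqnorm -(real_normK (num_real z.1)) -(real_normK (num_real z.2)).
rewrite mulrDl mul1r lerD// lerXn2r ?nnegrE//.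
Qed.

Lemma norm_le_sqnorm z : `|z| ^+ 2 <= sqnorm z.
Proof.
rewrite prod_normE maxEle; case: ifP => _; rewrite real_normK ?num_real// /sqnorm.
  by rewrite lerDr sqr_ge0.
by rewrite lerDl sqr_ge0.
Qed.

(** With [m = min (|.|^2, N)] and [|p| <= |q|], write
[m q q_1 - m p p_1 = m q (q_1 - p_1) + (m q - m p) p_1].  If the second term
does not vanish then [|p|^2 < N], and [m q - m p] is controlled by the
difference of the squared norms when [d] is small and by [N] when [d] is
large. *)
Lemma min_mul_lipschitz (p1 p2 q1 q2 N d : R) : 0 <= N ->
  `|q1 - p1| <= d -> `|q2 - p2| <= d -> p1 ^+ 2 + p2 ^+ 2 <= q1 ^+ 2 + q2 ^+ 2 ->
  `|Num.min (q1 ^+ 2 + q2 ^+ 2) N * q1 - Num.min (p1 ^+ 2 + p2 ^+ 2) N * p1|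
  <= (N + 6 * (N + 1) ^+ 2) * d.
Proof.
move=> N0 d1 d2; set sp := p1 ^+ 2 + _; set sq := q1 ^+ 2 + _ => pq.
set mq := Num.min sq N; set mp := Num.min sp N.
have d0 : 0 <= d by apply: le_trans d1.
have mq0 : 0 <= mq by rewrite le_min N0 addr_ge0// sqr_ge0.
have mqN : mq <= N by rewrite ge_min lexx orbT.
have mqp : mp <= mq by rewrite /mp /mq le_min !ge_min pq lexx orbT.
rewrite (_ : _ - _ = mq * (q1 - p1) + (mq - mp) * p1); last by ring.
rewrite [in leRHS]mulrDl; apply: (le_trans (ler_normD _ _)); apply: lerD.
  by rewrite normrM (ger0_norm mq0) ler_pM.
rewrite normrM ger0_norm ?subr_ge0//.
have [spN|spN] := leP N sp.
  rewrite (_ : mq - mp = 0) ?mul0r; last first.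
    by rewrite /mq /mp !min_r ?subrr// (le_trans spN).
  by rewrite ?mulr_ge0 ?addr_ge0.
have p1s : `|p1| <= N + 1.
  rewrite -(@ler_sqr _ `|p1|) ?nnegrE ?addr_ge0// real_normK ?num_real//.
  by apply: (@le_trans _ _ sp); rewrite ?lerDl ?sqr_ge0//; nra.
have p2s : `|p2| <= N + 1.
  rewrite -(@ler_sqr _ `|p2|) ?nnegrE ?addr_ge0// real_normK ?num_real//.
  by apply: (@le_trans _ _ sp); rewrite ?lerDr ?sqr_ge0//; nra.
suff h : mq - mp <= 6 * (N + 1) * d.
  rewrite expr2 [in leRHS](_ : _ * _ = 6 * (N + 1) * d * (N + 1)); last by ring.
  by apply: ler_pM => //; rewrite subr_ge0.
rewrite /mp (min_l (ltW spN)).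
have [dN|dN] := leP d (N + 1); last first.
  have sp0 : 0 <= sp by rewrite addr_ge0// sqr_ge0.
  by nra.
have : mq - sp <= sq - sp by rewrite lerB// ge_min lexx.
move=> /le_trans -> //; rewrite /sq /sp.
rewrite (_ : _ - _ = (q1 - p1) ^+ 2 + 2 * (p1 * (q1 - p1)) +
  ((q2 - p2) ^+ 2 + 2 * (p2 * (q2 - p2)))); last by ring.
have aux (p' x : R) : `|x| <= d -> `|p'| <= N + 1 ->
    x ^+ 2 + 2 * (p' * x) <= 3 * (N + 1) * d.
  move=> xd ps.
  have h1 : x ^+ 2 <= d * (N + 1).
    rewrite -(real_normK (num_real x)) expr2.
    by apply: ler_pM => //; apply: (le_trans xd).
  have h2 : p' * x <= (N + 1) * d.
    by apply: (le_trans (ler_norm _)); rewrite normrM ler_pM.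
  by lra.
by have := aux p1 _ d1 p1s; have := aux p2 _ d2 p2s; lra.
Qed.

Lemma truncated_drift_lipschitz N : 0 <= N ->
  exists2 L, 0 < L & forall p q,
    `|truncated_drift N p - truncated_drift N q| <= L * `|p - q|.
Proof.
move=> N0; pose K := N + 6 * (N + 1) ^+ 2.
have K0 : 0 <= K by rewrite addr_ge0// mulr_ge0// sqr_ge0.
pose L := `|alpha| + `|beta| + (`|a| + `|b|) * K.
exists (L + 1); first by rewrite ltr_wpDl// !addr_ge0// mulr_ge0// addr_ge0.
have main p q : sqnorm q <= sqnorm p ->
    `|truncated_drift N p - truncated_drift N q| <= (L + 1) * `|p - q|.
  move=> qp; set d := `|p - q|.
  have d0 : 0 <= d by exact: normr_ge0.
  have h1 : `|p.1 - q.1| <= d by exact: (norm_fst (p - q)).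
  have h2 : `|p.2 - q.2| <= d by exact: (norm_snd (p - q)).
  set mp := Num.min (sqnorm p) N; set mq := Num.min (sqnorm q) N.
  have k1 : `|mp * p.1 - mq * q.1| <= K * d by exact: min_mul_lipschitz.
  have k2 : `|mp * p.2 - mq * q.2| <= K * d.
    rewrite /mp /mq /sqnorm ![_.1 ^+ 2 + _]addrC.
    by apply: min_mul_lipschitz => //; rewrite ![_.2 ^+ 2 + _]addrC.
  have aux (c x y : R) : `|x| <= y -> `|c * x| <= `|c| * y.
    by move=> xy; rewrite normrM ler_wpM2l.
  apply: (@le_trans _ _ (L * d)); last by rewrite ler_wpM2r// lerDl.
  rewrite (_ : L * d = `|alpha| * d + `|beta| * d + (`|a| * (K * d) + `|b| * (K * d)));
    last by rewrite /L; ring.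
  rewrite norm_pair_le; apply/andP; split.
    rewrite [X in `|X|](_ : _ = alpha * (p.1 - q.1) - beta * (p.2 - q.2) -
      (a * (mp * p.1 - mq * q.1) - b * (mp * p.2 - mq * q.2))); last first.
      by rewrite /truncated_drift /damped -/mp -/mq /=; ring.
    apply: (le_trans (ler_normB _ _)); apply: lerD;
      by apply: (le_trans (ler_normB _ _)); apply: lerD; exact: aux.
  rewrite [X in `|X|](_ : _ = beta * (p.1 - q.1) + alpha * (p.2 - q.2) -
      (b * (mp * p.1 - mq * q.1) + a * (mp * p.2 - mq * q.2))); last first.
    by rewrite /truncated_drift /damped -/mp -/mq /=; ring.
  rewrite [leRHS](_ : _ = `|beta| * d + `|alpha| * d +
      (`|b| * (K * d) + `|a| * (K * d))); last by ring.
  apply: (le_trans (ler_normB _ _)); apply: lerD;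
    by apply: (le_trans (ler_normD _ _)); apply: lerD; exact: aux.
move=> p q; have [pq|/ltW pq] := leP (sqnorm q) (sqnorm p); first exact: main.
by rewrite distrC [`|p - q|]distrC; exact: main.
Qed.

Lemma continuous_truncated_drift N : 0 <= N -> continuous (truncated_drift N).
Proof.
move=> N0 z; have [L L0 hL] := truncated_drift_lipschitz N0.
apply/cvgrPdist_le => e e0; near=> y; apply: (le_trans (hL _ _)).
rewrite -ler_pdivlMl//; near: y.
by apply: cvgr_dist_le; [exact: cvg_id|rewrite mulr_gt0// invr_gt0].
Unshelve. all: by end_near.
Qed.

Lemma continuous_drift : continuous (drift alpha beta a b).
Proof.
move=> z; have e : drift alpha beta a b z = truncated_drift (2 * (`|z| + 1) ^+ 2) z.
  rewrite truncated_driftE// (le_trans (sqnorm_le_norm _))// ler_pM2l//.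
  by rewrite lerXn2r ?nnegrE ?addr_ge0// lerDl.
rewrite /continuous_at e.
have N0 : 0 <= 2 * (`|z| + 1) ^+ 2 by rewrite mulr_ge0// sqr_ge0.
have := continuous_truncated_drift N0 (x := z); apply: cvg_trans; apply: near_eq_cvg.
near=> y; rewrite truncated_driftE// (le_trans (sqnorm_le_norm _))// ler_pM2l//.
rewrite lerXn2r ?nnegrE ?addr_ge0// -lerBlDl.
apply: (le_trans (lerB_dist _ _)); rewrite distrC; near: y.
by apply: cvgr_dist_le; [exact: cvg_id|].
Unshelve. all: by end_near.
Qed.

Definition lin_const := 3 * `|alpha| + `|beta|.
Definition young_const := 2 * a + 2 * (b ^+ 2 / a).

(** Young's inequality on the cross terms.  The bracket that multiplies [m] is
negative as soon as [z] is large compared with the noise [u]. *)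
Lemma energy_le m z u : 0 <= m ->
  2 * ((z.1 - u.1) * (damped m z).1 + (z.2 - u.2) * (damped m z).2) <=
  lin_const * (sqnorm z + sqnorm u) + m * (young_const * sqnorm u - a * sqnorm z).
Proof.
move=> m0; rewrite /lin_const /young_const /damped /sqnorm /=.
move: z.1 z.2 u.1 u.2 => z1 z2 u1 u2.
have cE : a * (b ^+ 2 / a) = b ^+ 2 by rewrite mulrC divfK// gt_eqF.
move: (b ^+ 2 / a) cE => c cE.
have hlin : 2 * alpha * (z1 ^+ 2 + z2 ^+ 2) - 2 * alpha * (u1 * z1 + u2 * z2)
    - 2 * beta * (u2 * z1 - u1 * z2) <=
    (3 * `|alpha| + `|beta|) * (z1 ^+ 2 + z2 ^+ 2 + (u1 ^+ 2 + u2 ^+ 2)).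
  have aux (x y k : R) : 0 <= y -> `|x| <= y -> k * x <= `|k| * y.
    move=> y0 xy; apply: (le_trans (ler_norm _)).
    by rewrite normrM ler_wpM2l.
  have S : 0 <= z1 ^+ 2 + z2 ^+ 2 + (u1 ^+ 2 + u2 ^+ 2).
    by rewrite !addr_ge0// sqr_ge0.
  have Sz : 0 <= z1 ^+ 2 + z2 ^+ 2 by rewrite !addr_ge0// sqr_ge0.
  have Su : 0 <= u1 ^+ 2 + u2 ^+ 2 by rewrite !addr_ge0// sqr_ge0.
  have k1 : alpha * (2 * (z1 ^+ 2 + z2 ^+ 2) - 2 * (u1 * z1 + u2 * z2)) <=
      `|alpha| * (3 * (z1 ^+ 2 + z2 ^+ 2 + (u1 ^+ 2 + u2 ^+ 2))).
    apply: aux; first by rewrite mulr_ge0.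
    rewrite ler_norml; apply/andP; split.
      have := sqr_ge0 (z1 - u1); have := sqr_ge0 (z2 - u2).
      by rewrite !sqrrB; lra.
    have := sqr_ge0 (z1 + u1); have := sqr_ge0 (z2 + u2).
    by rewrite !sqrrD; lra.
  have k2 : (- beta) * (2 * (u2 * z1 - u1 * z2)) <=
      `|- beta| * (z1 ^+ 2 + z2 ^+ 2 + (u1 ^+ 2 + u2 ^+ 2)).
    apply: aux => //; rewrite ler_norml; apply/andP; split.
      have := sqr_ge0 (z1 + u2); have := sqr_ge0 (z2 - u1).
      by rewrite !sqrrB !sqrrD; lra.
    have := sqr_ge0 (z1 - u2); have := sqr_ge0 (z2 + u1).
    by rewrite !sqrrB !sqrrD; lra.
  by move: k1 k2; rewrite normrN; lra.
have hyoung : - 2 * a * (z1 ^+ 2 + z2 ^+ 2) + 2 * a * (u1 * z1 + u2 * z2)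
    + 2 * b * (u2 * z1 - u1 * z2) <=
    (2 * a + 2 * c) * (u1 ^+ 2 + u2 ^+ 2) - a * (z1 ^+ 2 + z2 ^+ 2).
  have y1 (x y : R) : 2 * a * (x * y) <= a / 2 * y ^+ 2 + 2 * a * x ^+ 2.
    have : 0 <= a / 2 * (y - 2 * x) ^+ 2 by rewrite mulr_ge0 ?sqr_ge0 ?divr_ge0// ltW.
    by rewrite sqrrB; lra.
  have y2 (x y : R) : 2 * b * (x * y) <= a / 2 * y ^+ 2 + 2 * c * x ^+ 2.
    rewrite -(ler_pM2l a_gt0).
    have : 0 <= (a * y - 2 * b * x) ^+ 2 / 2 by rewrite divr_ge0 ?sqr_ge0.
    have e : a * (2 * c * x ^+ 2) = 2 * b ^+ 2 * x ^+ 2 by rewrite -cE; ring.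
    rewrite mulrDr e.
    by rewrite sqrrB; lra.
  have := y1 u1 z1; have := y1 u2 z2; have := y2 u2 z1.
  by have := y2 (- u1) z2; rewrite sqrrN; lra.
have := ler_wpM2l m0 hyoung; move: hlin; lra.
Qed.

Lemma sqnorm_le_sub z u : sqnorm z <= 2 * sqnorm (z - u) + 2 * sqnorm u.
Proof.
rewrite /sqnorm /=; move: z.1 z.2 u.1 u.2 => z1 z2 u1 u2.
have := sqr_ge0 (z1 - 2 * u1); have := sqr_ge0 (z2 - 2 * u2); lra.
Qed.

Lemma sqnorm_sub_le z u : sqnorm (z - u) <= 2 * sqnorm z + 2 * sqnorm u.
Proof.
rewrite /sqnorm /=; move: z.1 z.2 u.1 u.2 => z1 z2 u1 u2.
have := sqr_ge0 (z1 + u1); have := sqr_ge0 (z2 + u2); lra.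
Qed.

Lemma young_ge0 : 0 <= young_const.
Proof.
have a0 := ltW a_gt0; apply: addr_ge0; apply: mulr_ge0 => //.
by rewrite divr_ge0 ?sqr_ge0.
Qed.

Lemma lin_ge0 : 0 <= lin_const.
Proof. by rewrite addr_ge0// mulr_ge0. Qed.

(** The value of [m (young_const U - a |z|^2)] for [0 <= m <= |z|^2] never
exceeds [(young_const U)^2 / a], whatever the truncation. *)
Definition growth_const (U : R) :=
  3 * lin_const * U + young_const ^+ 2 * U ^+ 2 / a.

(** Uniform in [m], hence in the truncation level: it excludes explosion for
all truncated equations at once. *)
Lemma growth_energy m z u U : 0 <= m -> m <= sqnorm z -> sqnorm u <= U ->
  2 * ((z.1 - u.1) * (damped m z).1 + (z.2 - u.2) * (damped m z).2) <=
  2 * lin_const * sqnorm (z - u) + growth_const U.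
Proof.
move=> m0 mz uU; apply: (le_trans (energy_le _ _ m0)); rewrite /growth_const.
have h1 := sqnorm_le_sub z u; have l0 := lin_ge0; have k0 := young_ge0.
have U0 := le_trans (sqnorm_ge0 u) uU.
have h : m * (young_const * sqnorm u - a * sqnorm z) <= young_const ^+ 2 * U ^+ 2 / a.
  have kU : young_const * sqnorm u <= young_const * U by rewrite ler_wpM2l.
  have rhs0 : 0 <= young_const ^+ 2 * U ^+ 2 / a.
    by rewrite divr_ge0 ?mulr_ge0 ?sqr_ge0// ltW.
  have [neg|pos] := leP (young_const * U) (a * sqnorm z).
    apply: (le_trans _ rhs0); rewrite mulr_ge0_le0// subr_le0.
    exact: le_trans neg.
  rewrite ler_pdivlMr// -exprMn.
  apply: (@le_trans _ _ ((a * m) * (young_const * U))).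
    rewrite [leLHS](_ : _ =
      (a * m) * (young_const * sqnorm u - a * sqnorm z)); last by ring.
    rewrite ler_wpM2l ?mulr_ge0 ?(ltW a_gt0)// lerBlDr (le_trans kU)// lerDl.
    by rewrite mulr_ge0 ?(ltW a_gt0) ?sqnorm_ge0.
  rewrite expr2 ler_wpM2r ?mulr_ge0//.
  by apply: le_trans (ltW pos); rewrite ler_pM2l.
suff : lin_const * (sqnorm z + sqnorm u) <=
   lin_const * (3 * U) + 2 * lin_const * sqnorm (z - u) by lra.
rewrite (_ : _ + _ = lin_const * (3 * U + 2 * sqnorm (z - u))); last by ring.
by rewrite ler_wpM2l//; lra.
Qed.

Definition damping_const (U : R) :=
  lin_const ^+ 2 / a + lin_const * U + (young_const ^+ 2 / a + a / 2) * U ^+ 2.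

(** Without truncation half of the quartic term survives.  The constant
[a / 16] accounts for passing from [z] to [z - u] in the fourth power. *)
Lemma damping_energy z u U : sqnorm u <= U ->
  2 * ((z.1 - u.1) * (drift alpha beta a b z).1 +
       (z.2 - u.2) * (drift alpha beta a b z).2) <=
  - (a / 16) * sqnorm (z - u) ^+ 2 + damping_const U.
Proof.
move=> uU; rewrite driftE; apply: (le_trans (energy_le _ _ (sqnorm_ge0 z))).
rewrite /damping_const.
have h1 := sqnorm_sub_le z u; have l0 := lin_ge0; have k0 := young_ge0.
have U0 := le_trans (sqnorm_ge0 u) uU.
have Z0 := sqnorm_ge0 z; have V0 := sqnorm_ge0 (z - u).
have u0 := sqnorm_ge0 u.
move: (sqnorm z) (sqnorm u) (sqnorm (z - u)) lin_const young_const
  h1 l0 k0 U0 Z0 V0 u0 uU.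
move=> q w V l k h1 l0 k0 U0 Z0 V0 u0 uU.
have e1 : l * q <= a / 4 * q ^+ 2 + l ^+ 2 / a.
  have e : l ^+ 2 / a = a * (l / a) ^+ 2 by field; rewrite gt_eqF.
  have : 0 <= a * (q / 2 - l / a) ^+ 2 by rewrite mulr_ge0 ?sqr_ge0// ltW.
  have -> : a * (q / 2 - l / a) ^+ 2 = a / 4 * q ^+ 2 - l * q + a * (l / a) ^+ 2.
    by field; rewrite gt_eqF.
  by rewrite e; lra.
have e2 : k * U * q <= a / 4 * q ^+ 2 + k ^+ 2 / a * U ^+ 2.
  have e : k ^+ 2 / a * U ^+ 2 = a * (k * U / a) ^+ 2 by field; rewrite gt_eqF.
  have : 0 <= a * (q / 2 - k * U / a) ^+ 2 by rewrite mulr_ge0 ?sqr_ge0// ltW.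
  have -> : a * (q / 2 - k * U / a) ^+ 2 =
      a / 4 * q ^+ 2 - k * U * q + a * (k * U / a) ^+ 2.
    by field; rewrite gt_eqF.
  by rewrite e; lra.
have e3 : l * w <= l * U by rewrite ler_wpM2l.
have e4 : k * w * q <= k * U * q by rewrite ler_wpM2r// ler_wpM2l.
have e5 : V ^+ 2 <= 8 * q ^+ 2 + 8 * U ^+ 2.
  have : V ^+ 2 <= (2 * q + 2 * U) ^+ 2.
    by rewrite lerXn2r ?nnegrE//; lra.
  have := sqr_ge0 (q - U); rewrite sqrrB sqrrD; lra.
have e6 : a / 16 * V ^+ 2 <= a / 16 * (8 * q ^+ 2 + 8 * U ^+ 2).
  by rewrite ler_wpM2l// divr_ge0// ltW.
lra.
Qed.

End truncated_drift.

(** * The integral equation along one path *)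

Section integral_equation.
Context {R : realType}.
Implicit Types (F : R * R -> R * R) (u y : R -> R * R) (Z : R * R) (t T : R).

Definition integral_solution F u Z T y :=
  continuous y /\
  forall t, 0 <= t <= T -> y t = Z + integral0 (F \o y) t + u t.

Lemma pair_ext (z z' : R * R) : z.1 = z'.1 -> z.2 = z'.2 -> z = z'.
Proof. by case: z z' => [? ?] [? ?] /= -> ->. Qed.

(** Stated for [Z + integral0 g], which is defined for all times and
differentiable for positive ones, rather than for a solution, which is only
known on an interval. *)
Lemma is_derive_sqnorm (g : R -> R * R) Z t : continuous g -> 0 < t ->
  is_derive t 1 (fun s => sqnorm (Z + integral0 g s))
    (2 * ((Z + integral0 g t).1 * (g t).1 + (Z + integral0 g t).2 * (g t).2)).
Proof.
move=> cg t0; rewrite /sqnorm.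
have d1 := is_derive_primitive (continuous_fst_comp cg) t0.
have d2 := is_derive_primitive (continuous_snd_comp cg) t0.
set p1 := primitive _ in d1; set p2 := primitive _ in d2.
have -> : (fun s => (Z + integral0 g s).1 ^+ 2 + (Z + integral0 g s).2 ^+ 2) =
  (fun s => (Z.1 + p1 s) ^+ 2 + (Z.2 + p2 s) ^+ 2) by [].
rewrite -[(Z + integral0 g t).1]/(Z.1 + p1 t) -[(Z + integral0 g t).2]/(Z.2 + p2 t).
by apply: is_derive_eq; rewrite /GRing.scale/=; ring.
Qed.

Lemma continuous_sqnorm (g : R -> R * R) : continuous g ->
  continuous (fun t => sqnorm (g t)).
Proof.
move=> cg; rewrite (_ : (fun t => _) =
  (fun t => (g t).1 * (g t).1 + (g t).2 * (g t).2)); last by apply/funext.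
have c1 := continuous_fst_comp cg; have c2 := continuous_snd_comp cg.
by move=> t; apply: cvgD; apply: cvgM; [exact: c1|exact: c1|exact: c2|exact: c2].
Qed.

Lemma integral0_at0 (g : R -> R * R) : integral0 g 0 = 0.
Proof. by rewrite integral0E !primitive_le0. Qed.

Lemma continuous_addl (g : R -> R * R) Z : continuous g ->
  continuous (fun t => Z + g t).
Proof. by move=> cg t; apply: cvgD; [exact: cvg_cst|exact: cg]. Qed.

Lemma bounded_noise u T : continuous u ->
  exists2 U, 0 <= U & forall t, 0 <= t <= T -> sqnorm (u t) <= U.
Proof.
move=> cu; have [T0|T0] := leP 0 T; last first.
  by exists 0 => // t /andP[t0 tT]; move: T0; rewrite ltNge (le_trans t0).
have cs := continuous_sqnorm cu.
have [c _ hc] := EVT_max T0 (@continuous_subspaceT _ _ `[0, T] _ cs).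
exists (sqnorm (u c)); first exact: sqnorm_ge0.
by move=> t tT; apply: hc; rewrite in_itv.
Qed.

Lemma solution_sub F u Z T y t : integral_solution F u Z T y -> 0 <= t <= T ->
  Z + integral0 (F \o y) t = y t - u t.
Proof. by move=> [_ ey] tT; rewrite (ey t tT) addrK. Qed.

Lemma constant_of_derive (f : R -> R) T : 0 <= T -> continuous f ->
  (forall t, 0 < t < T -> is_derive t 1 f 0) -> f T = f 0.
Proof.
move=> T0 cf df; apply/eqP; rewrite eq_le; apply/andP; split.
  exact: (nonincreasing_of_derive (df := fun=> 0) T0).
rewrite -lerN2.
have := @nonincreasing_of_derive R (fun t => - f t) (fun=> 0) T T0; apply => //.
  by move=> t; apply: cvgN; exact: cf.
by move=> t /df h; apply: is_derive_eq; rewrite oppr0.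
Qed.

Lemma primitive_shift (g : R -> R) s t : continuous g -> 0 <= s -> 0 <= t ->
  primitive g (s + t) = primitive g s + primitive (fun r => g (s + r)) t.
Proof.
move=> cg s0 t0.
have cs : continuous (fun r => s + r :> R).
  by move=> r; apply: cvgD; [exact: cvg_cst|exact: cvg_id].
have cgs : continuous (fun r => g (s + r)).
  by move=> r; apply: (@continuous_comp _ _ _ (fun r => s + r) g); [exact: cs|exact: cg].
have cps : continuous (fun r => primitive g (s + r)).
  move=> r; apply: (@continuous_comp _ _ _ (fun r => s + r) (primitive g)).
    exact: cs.
  exact: continuous_primitive.
suff K : primitive g (s + t) - primitive (fun r => g (s + r)) t = primitive g s.
  by rewrite -K subrK.
have := @constant_of_derive
  (fun r => primitive g (s + r) - primitive (fun r => g (s + r)) r) t t0.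
rewrite addr0 [primitive _ 0]primitive_le0// subr0; apply.
  by move=> r; apply: cvgB; [exact: cps|exact: continuous_primitive].
move=> r /andP[r0 _].
have d1 := is_derive_primitive cgs r0.
have sr : 0 < s + r by rewrite ltr_wpDl.
have d2 : is_derive (s + r) 1 (primitive g) (g (s + r)) := is_derive_primitive cg sr.
have d3 : is_derive r 1 (fun r => s + r) 1.
  by apply: is_derive_eq; rewrite add0r mulr1.
have d4 := @is_derive1_comp R (primitive g) (fun r => s + r) r (g (s + r)) 1 d2 d3.
have {}d4 : is_derive r 1 (fun r => primitive g (s + r)) (g (s + r)).
  by move: d4; rewrite mulr1 .
by apply: is_derive_eq; rewrite subrr.
Qed.

Lemma integral0_shift (g : R -> R * R) s t : continuous g -> 0 <= s -> 0 <= t ->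
  integral0 g (s + t) = integral0 g s + integral0 (fun r => g (s + r)) t.
Proof.
move=> cg s0 t0; rewrite !integral0E !primitive_shift//.
  exact: continuous_snd_comp.
exact: continuous_fst_comp.
Qed.

Lemma integral0_eq (g h : R -> R * R) t :
  (forall s, 0 <= s <= t -> g s = h s) -> integral0 g t = integral0 h t.
Proof.
move=> gh; rewrite /integral0; congr (_, _); apply: eq_Rintegral => s;
  by rewrite inE/= in_itv/= => /gh ->.
Qed.

(** The noise cancels in the difference of two solutions, which is therefore
differentiable. *)
Lemma lipschitz_stability F L u Z Z' T y y' : 0 <= L -> continuous F ->
  (forall p q, `|F p - F q| <= L * `|p - q|) ->
  integral_solution F u Z T y -> integral_solution F u Z' T y' ->
  forall t, 0 <= t <= T ->
    sqnorm (y t - y' t) <= sqnorm (Z - Z') * expR (4 * L * t).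
Proof.
move=> L0 cF FL sy sy' t /andP[t0 tT].
have [cy _] := sy; have [cy' _] := sy'.
have cFy : continuous (F \o y).
  by move=> s; apply: continuous_comp; [exact: cy|exact: cF].
have cFy' : continuous (F \o y').
  by move=> s; apply: continuous_comp; [exact: cy'|exact: cF].
pose g s := F (y s) - F (y' s).
have cg : continuous g by move=> s; apply: cvgB; [exact: cFy|exact: cFy'].
have gE s : 0 <= s <= T -> Z - Z' + integral0 g s = y s - y' s.
  move=> sT; transitivity ((y s - u s) - (y' s - u s)); last first.
    by rewrite opprB addrA subrK.
  rewrite -(solution_sub sy sT) -(solution_sub sy' sT) opprD addrACA.
  congr (_ + _); apply: pair_ext => /=; apply: RintegralB => //;
    apply: continuous_integrable;
    by [exact: continuous_fst_comp|exact: continuous_snd_comp].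
have := @gronwall R (fun s => sqnorm (Z - Z' + integral0 g s)) _ (4 * L) 0 t t0
  _ (lexx _) _ (fun s ts => is_derive_sqnorm (Z - Z') cg (andP ts).1).
rewrite mul0r addr0 gE ?t0// integral0_at0 addr0.
apply; first by rewrite mulr_ge0.
  by apply: continuous_sqnorm; apply: continuous_addl; exact: continuous_integral0.
move=> s /andP[s0 st]; rewrite gE; last by rewrite (ltW s0) (le_trans (ltW st)).
rewrite addr0; set D := y s - y' s.
have h1 : `|(g s).1| <= L * `|D| by apply: le_trans (norm_fst _) (FL _ _).
have h2 : `|(g s).2| <= L * `|D| by apply: le_trans (norm_snd _) (FL _ _).
have d0 : 0 <= `|D| by exact: normr_ge0.
have k1 : D.1 * (g s).1 <= `|D| * (L * `|D|).
  apply: (le_trans (ler_norm _)); rewrite normrM ler_pM//; exact: norm_fst.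
have k2 : D.2 * (g s).2 <= `|D| * (L * `|D|).
  apply: (le_trans (ler_norm _)); rewrite normrM ler_pM//; exact: norm_snd.
have k3 : L * `|D| ^+ 2 <= L * sqnorm D by rewrite ler_wpM2l// norm_le_sqnorm.
rewrite expr2 in k3; nra.
Qed.

End integral_equation.

Section hopf_equation.
Context {R : realType}.
Variables (alpha beta a b : R).
Hypothesis a_gt0 : 0 < a.
Implicit Types (F : R * R -> R * R) (u y : R -> R * R) (Z : R * R) (t T N U : R).

Local Notation f := (drift alpha beta a b).
Local Notation tf := (truncated_drift alpha beta a b).

(** Twice the Gronwall bound on [|y - u|^2], plus [2 |u|^2] to return to [y]. *)
Definition apriori_bound Z U T : R :=
  2 * ((sqnorm Z + growth_const alpha beta a b U * T) *
       expR (2 * lin_const alpha beta * T)) + 2 * U.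

Lemma growth_const_ge0 U : 0 <= U -> 0 <= growth_const alpha beta a b U.
Proof.
move=> U0; apply: addr_ge0; first by rewrite mulr_ge0// mulr_ge0// lin_ge0.
by apply: divr_ge0; [rewrite -exprMn sqr_ge0|exact: ltW].
Qed.

Lemma solution_bound F u Z T y U : continuous F -> 0 <= U ->
  (forall z, exists m, [/\ 0 <= m, m <= sqnorm z & F z = damped alpha beta a b m z]) ->
  (forall t, 0 <= t <= T -> sqnorm (u t) <= U) ->
  integral_solution F u Z T y ->
  forall t, 0 <= t <= T -> sqnorm (y t) <= apriori_bound Z U T.
Proof.
move=> cF U0 Fm uU sy t /andP[t0 tT]; have [cy _] := sy.
have cFy : continuous (F \o y).
  by move=> s; apply: continuous_comp; [exact: cy|exact: cF].
have g0 := growth_const_ge0 U0; have l0 := lin_ge0 alpha beta.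
have := @gronwall R (fun s => sqnorm (Z + integral0 (F \o y) s)) _
  (2 * lin_const alpha beta) (growth_const alpha beta a b U) t t0
  _ g0 _ (fun s ts => is_derive_sqnorm Z cFy (andP ts).1).
rewrite integral0_at0 addr0 (solution_sub sy) ?t0// => H.
have {}H : sqnorm (y t - u t) <= (sqnorm Z + growth_const alpha beta a b U * t) *
    expR (2 * lin_const alpha beta * t).
  apply: H.
  - by rewrite mulr_ge0.
  - by apply: continuous_sqnorm; apply: continuous_addl; exact: continuous_integral0.
  - move=> s /andP[s0 st].
    have sT : 0 <= s <= T by rewrite (ltW s0) (le_trans (ltW st)).
    rewrite (solution_sub sy sT) /=; have [m [m0 mz ->]] := Fm (y s).
    by apply: growth_energy => //; exact: uU.
apply: (le_trans (sqnorm_le_sub (y t) (u t))); rewrite /apriori_bound.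
apply: lerD; last by rewrite ler_pM2l// uU// t0.
rewrite ler_pM2l//; apply: (le_trans H).
apply: ler_pM.
- by rewrite addr_ge0 ?sqnorm_ge0// mulr_ge0.
- exact: expR_ge0.
- by rewrite lerD2l ler_wpM2l.
- by rewrite ler_expR ler_wpM2l// mulr_ge0.
Qed.

Lemma truncated_drift_damped N z : 0 <= N ->
  exists m, [/\ 0 <= m, m <= sqnorm z & tf N z = damped alpha beta a b m z].
Proof.
move=> N0; exists (Num.min (sqnorm z) N); split => //.
  by rewrite le_min sqnorm_ge0 N0.
by rewrite ge_min lexx.
Qed.

Lemma drift_damped z :
  exists m, [/\ 0 <= m, m <= sqnorm z & f z = damped alpha beta a b m z].
Proof. by exists (sqnorm z); rewrite driftE lexx sqnorm_ge0. Qed.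

(** Both kinds of solutions stay where the truncation is inactive. *)
Lemma truncated_solution u Z T y U N : 0 <= U -> 0 <= N ->
  (forall t, 0 <= t <= T -> sqnorm (u t) <= U) ->
  apriori_bound Z U T <= N ->
  integral_solution (tf N) u Z T y <-> integral_solution f u Z T y.
Proof.
move=> U0 N0 uU ZN; split=> sy; have [cy ey] := sy.
  have B := solution_bound (@continuous_truncated_drift _ alpha beta a b _ N0) U0
    (fun z => truncated_drift_damped z N0) uU sy.
  split=> // t tT; rewrite ey//; congr (_ + _ + _); apply: integral0_eq => s sT /=.
  rewrite truncated_driftE//; apply: le_trans ZN; apply: B.
  by move: sT tT => /andP[-> st] /andP[_]; exact: le_trans.
have B := solution_bound (@continuous_drift _ alpha beta a b) U0
  (fun z => drift_damped z) uU sy.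
split=> // t tT; rewrite ey//; congr (_ + _ + _); apply: integral0_eq => s sT /=.
rewrite truncated_driftE//; apply: le_trans ZN; apply: B.
by move: sT tT => /andP[-> st] /andP[_]; exact: le_trans.
Qed.

(** The constant [L] is uniform in the initial points that share the bound [N];
this gives uniqueness and continuity in the initial point together. *)
Lemma drift_stability u T U N : 0 <= U -> 0 <= N ->
  (forall t, 0 <= t <= T -> sqnorm (u t) <= U) ->
  exists2 L, 0 < L & forall Z Z' y y',
    apriori_bound Z U T <= N -> apriori_bound Z' U T <= N ->
    integral_solution f u Z T y -> integral_solution f u Z' T y' ->
    forall t, 0 <= t <= T ->
      sqnorm (y t - y' t) <= sqnorm (Z - Z') * expR (4 * L * t).
Proof.
move=> U0 N0 uU; have [L L0 hL] := @truncated_drift_lipschitz _ alpha beta a b _ N0.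
exists L => // Z Z' y y' ZN ZN' sy sy'.
apply: (lipschitz_stability (ltW L0)
  (@continuous_truncated_drift _ alpha beta a b _ N0) hL).
  exact/(truncated_solution y U0 N0 uU ZN).
exact/(truncated_solution y' U0 N0 uU ZN').
Qed.

Lemma sqnorm_eq0 (z : R * R) : sqnorm z <= 0 -> z = 0.
Proof.
move=> z0; apply/eqP; rewrite -normr_le0.
have := le_trans (norm_le_sqnorm z) z0.
by rewrite -[leRHS](expr0n _ 2) ler_sqr// nnegrE.
Qed.

Lemma drift_uniqueness u Z T y y' : continuous u ->
  integral_solution f u Z T y -> integral_solution f u Z T y' ->
  forall t, 0 <= t <= T -> y t = y' t.
Proof.
move=> cu sy sy' t tT; have [U U0 uU] := bounded_noise T cu.
have N0 : 0 <= Num.max 0 (apriori_bound Z U T) by rewrite le_max lexx.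
have [L L0 hL] := drift_stability U0 N0 uU.
have ZN : apriori_bound Z U T <= Num.max 0 (apriori_bound Z U T).
  by rewrite le_max lexx orbT.
have := hL _ _ _ _ ZN ZN sy sy' t tT.
rewrite subrr [sqnorm 0](_ : _ = 0) ?mul0r; last by rewrite /sqnorm/= expr0n addr0.
by move/sqnorm_eq0/eqP; rewrite subr_eq0 => /eqP.
Qed.

(** By completing the square, [(t^2 E)' <= 2 t E - c t^2 E^2 + M t^2] is at
most [1 / c + M] for [t <= 1], where [E = |y - u|^2] and [c = a / 16].  The
factor [t^2] removes the initial value of [E]. *)
Lemma coming_down_from_infinity u Z y U :
  (forall t, 0 <= t <= 1 -> sqnorm (u t) <= U) ->
  integral_solution f u Z 1 y ->
  sqnorm (y 1 - u 1) <= 16 / a + damping_const alpha beta a b U.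
Proof.
move=> uU sy; have [cy _] := sy.
have cFy : continuous (f \o y).
  by move=> s; apply: continuous_comp; [exact: cy|exact: continuous_drift].
set M := damping_const _ _ _ _ _.
pose E (s : R) := sqnorm (Z + integral0 (f \o y) s).
have EE (s : R) : 0 <= s <= 1 -> E s = sqnorm (y s - u s).
  by move=> s1; rewrite /E (solution_sub sy).
have cE : continuous E.
  by apply: continuous_sqnorm; apply: continuous_addl; exact: continuous_integral0.
pose dE (s : R) := 2 * ((Z + integral0 (f \o y) s).1 * (f (y s)).1 +
                  (Z + integral0 (f \o y) s).2 * (f (y s)).2).
have dEE (s : R) : 0 < s -> is_derive s 1 E (dE s) by exact: is_derive_sqnorm.
have dEle (s : R) : 0 <= s <= 1 -> dE s <= - (a / 16) * E s ^+ 2 + M.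
  move=> s1; rewrite EE// /dE (solution_sub sy s1).
  by apply: damping_energy => //; exact: uU.
have M0 : 0 <= M.
  have U0 : 0 <= U by apply: le_trans (uU 0 _); rewrite ?sqnorm_ge0// lexx ler01.
  have := lin_ge0 alpha beta; have := ltW a_gt0 => a0 l0.
  rewrite /M /damping_const; apply: addr_ge0; first apply: addr_ge0.
  - by rewrite divr_ge0// sqr_ge0.
  - exact: mulr_ge0.
  - by rewrite mulr_ge0 ?sqr_ge0// addr_ge0// divr_ge0// sqr_ge0.
have := @nonincreasing_of_derive R (fun s => s ^+ 2 * E s - (16 / a + M) * s)
  (fun s => 2 * s * E s + s ^+ 2 * dE s - (16 / a + M)) 1 ler01.
rewrite expr1n mul1r mulr1 expr0n mul0r mulr0 subr0 EE ?ler01 ?lexx//.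
rewrite subr_le0; apply.
- move=> s; apply: cvgB; last by apply: cvgM; [exact: cvg_cst|exact: cvg_id].
  by apply: cvgM; [exact: exprn_continuous|exact: cE].
- move=> s /andP[s0 _]; have ? := dEE s s0.
  by apply: is_derive_eq; rewrite /GRing.scale/=; ring.
- move=> s /andP[s0 s1]; have := dEle s; rewrite (ltW s0) (ltW s1) => /(_ isT) h.
  have s2 : s ^+ 2 <= 1 by rewrite expr_le1// ltW.
  have s20 : 0 <= s ^+ 2 by exact: sqr_ge0.
  have k1 : s ^+ 2 * dE s <= s ^+ 2 * (- (a / 16) * E s ^+ 2 + M) by rewrite ler_wpM2l.
  have k2 : s ^+ 2 * M <= M by rewrite ler_piMl.
  have k3 : 0 <= a / 16 * (s * E s - 16 / a) ^+ 2.
    by rewrite mulr_ge0 ?sqr_ge0 ?divr_ge0 ?ltW.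
  have k4 : a / 16 * (s * E s - 16 / a) ^+ 2 =
      a / 16 * (s ^+ 2 * E s ^+ 2) - 2 * s * E s + 16 / a.
    by field; rewrite gt_eqF.
  rewrite k4 in k3; lra.
Qed.

End hopf_equation.

(** * The solution map *)

Section existence.
Context {R : realType}.
Variables (alpha beta a b : R).
Hypothesis a_gt0 : 0 < a.
Implicit Types (u y : R -> R * R) (Z : R * R) (t T : R) (k : nat).

Local Notation f := (drift alpha beta a b).
Local Notation tf := (truncated_drift alpha beta a b).

(** Subtracting the noise turns the truncated equation into an ordinary
differential equation with a time-dependent field. *)
Definition field_along k u (s : R) (p : R * R) : R * R := tf k%:R (p + u s).

Definition truncated_solve k u Z t : R * R := picard_lim (field_along k u) Z t + u t.

(** The sequence is eventually constant in [k], locally uniformly in [t]; a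
limit, instead of a choice of [k], keeps the map measurable. *)
Definition solve u Z t : R * R := pair_lim (fun k => truncated_solve k u Z t).

Lemma field_along_continuous k u y : continuous u -> continuous y ->
  continuous (fun s => field_along k u s (y s)).
Proof.
move=> cu cy s.
apply: (@continuous_comp _ _ _ (fun s => y s + u s) (tf k%:R)).
  by apply: cvgD; [exact: cy|exact: cu].
exact: continuous_truncated_drift.
Qed.

Lemma field_along_lipschitz k : exists2 L, 0 < L &
  forall u s p q, `|field_along k u s p - field_along k u s q| <= L * `|p - q|.
Proof.
have [L L0 hL] := @truncated_drift_lipschitz _ alpha beta a b k%:R (ler0n _ k).
exists L => // u s p q; rewrite /field_along (le_trans (hL _ _))//.
by rewrite opprD addrACA subrr addr0.
Qed.

Lemma truncated_solve_solution k u Z T : continuous u ->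
  integral_solution (tf k%:R) u Z T (truncated_solve k u Z).
Proof.
move=> cu; have [L L0 hL] := field_along_lipschitz k.
have Gc y := @field_along_continuous k u y cu.
split=> [t|t _].
  by apply: cvgD; [exact: (continuous_picard_lim L0 Gc (hL u))|exact: cu].
by rewrite /truncated_solve {1}(picard_limE L0 Gc (hL u)).
Qed.

Lemma truncated_solve_le0 k u Z t : continuous u -> t <= 0 ->
  truncated_solve k u Z t = Z + u t.
Proof.
move=> cu t0; have [L L0 hL] := field_along_lipschitz k.
have Gc y := @field_along_continuous k u y cu.
rewrite /truncated_solve (picard_limE L0 Gc (hL u)) integral0E !primitive_le0//.
by rewrite (_ : (0, 0) = 0)// addr0.
Qed.

Lemma truncated_solve_stable u Z T : continuous u ->
  exists K, integral_solution f u Z T (truncated_solve K u Z) /\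
    forall k t, (K <= k)%N -> t <= T ->
      truncated_solve k u Z t = truncated_solve K u Z t.
Proof.
move=> cu; have [U U0 uU] := bounded_noise T cu.
have [K /ltW hK] : exists K, apriori_bound alpha beta a b Z U T < K%:R.
  by exists (Num.trunc (apriori_bound alpha beta a b Z U T)).+1; exact: truncnS_gt.
have sol k : (K <= k)%N -> integral_solution f u Z T (truncated_solve k u Z).
  move=> Kk.
  have kN : apriori_bound alpha beta a b Z U T <= k%:R.
    by rewrite (le_trans hK)// ler_nat.
  have [h _] := truncated_solution a_gt0 (truncated_solve k u Z) U0 (ler0n R k) uU kN.
  exact/h/truncated_solve_solution.
exists K; split; first exact: sol.
move=> k t Kk tT; have [t0|t0] := leP t 0; first by rewrite !truncated_solve_le0.
apply: (drift_uniqueness a_gt0 cu (sol _ Kk) (sol _ (leqnn K))).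
by rewrite ltW.
Qed.

Lemma pair_lim_near_cst (x : nat -> R * R) l K :
  (forall k, (K <= k)%N -> x k = l) -> pair_lim x = l.
Proof.
move=> xl; apply: pair_ext; apply: lim_near_cst => //.
  by exists K => // k /= /xl ->.
by exists K => // k /= /xl ->.
Qed.

Lemma solve_eq_truncated_solve u Z T : continuous u ->
  exists K, integral_solution f u Z T (truncated_solve K u Z) /\
    forall t, t <= T -> solve u Z t = truncated_solve K u Z t.
Proof.
move=> cu; have [K [sK hK]] := truncated_solve_stable Z T cu.
exists K; split=> // t tT; apply: (@pair_lim_near_cst _ _ K) => k Kk; exact: hK.
Qed.

Lemma continuous_solve u Z : continuous u -> continuous (solve u Z).
Proof.
move=> cu; apply: continuous_of_approx => t e e0.
have [K [[ck _] hK]] := solve_eq_truncated_solve Z (t + 1) cu.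
exists (truncated_solve K u Z); split=> // s st; rewrite hK// subrr normr0; exact: ltW.
Qed.

Lemma solve_solution u Z T : continuous u ->
  integral_solution f u Z T (solve u Z).
Proof.
move=> cu; split; first exact: continuous_solve.
have [K [[_ ek] hK]] := solve_eq_truncated_solve Z T cu.
move=> t /andP[t0 tT]; rewrite hK// ek ?t0//; congr (_ + _ + _).
by apply: integral0_eq => s /andP[_ st]; rewrite /comp hK// (le_trans st).
Qed.

Lemma solve_le0 u Z t : continuous u -> t <= 0 -> solve u Z t = Z + u t.
Proof.
move=> cu t0; have [K [_ ->//]] := solve_eq_truncated_solve Z t cu.
exact: truncated_solve_le0.
Qed.

Lemma solve_unique u Z T y : continuous u -> integral_solution f u Z T y ->
  forall t, 0 <= t <= T -> y t = solve u Z t.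
Proof.
by move=> cu sy; apply: (drift_uniqueness a_gt0 cu sy); exact: solve_solution.
Qed.

(** The solution up to time [T] sees the noise only on [[0, T]]. *)
Lemma solve_local u u' Z T : continuous u -> continuous u' ->
  (forall t, 0 <= t <= T -> u t = u' t) ->
  forall t, 0 <= t <= T -> solve u Z t = solve u' Z t.
Proof.
move=> cu cu' uu'; apply: solve_unique => //.
have [cs es] := solve_solution Z T cu; split=> // t tT.
by rewrite es// uu'.
Qed.

Lemma solve_flow u Z s t : continuous u -> 0 <= s -> 0 <= t ->
  solve u Z (s + t) = solve (fun r => u (s + r) - u s) (solve u Z s) t.
Proof.
move=> cu s0 t0.
have cr : continuous (fun r => s + r :> R).
  by move=> r; apply: cvgD; [exact: cvg_cst|exact: cvg_id].
have cus : continuous (fun r => u (s + r) - u s).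
  move=> r; apply: cvgB; last exact: cvg_cst.
  by apply: (@continuous_comp _ _ _ (fun r => s + r) u); [exact: cr|exact: cu].
have [cy ey] := solve_solution Z (s + t) cu.
apply: (solve_unique (T := t) (y := fun r => solve u Z (s + r)) cus); last first.
  by rewrite t0 lexx.
split=> [r|r /andP[r0 rt]].
  by apply: (@continuous_comp _ _ _ (fun r => s + r) (solve u Z)); [exact: cr|exact: cy].
have cfy : continuous (f \o solve u Z).
  by move=> q; apply: continuous_comp; [exact: cy|exact: continuous_drift].
rewrite ey ?addr_ge0//; last by rewrite lerD2l.
rewrite (ey s) ?s0; last by rewrite lerDl.
rewrite integral0_shift//; set A := integral0 _ s; set B := integral0 _ r.
apply/esym/eqP; rewrite addrA subr_eq; apply/eqP.
by rewrite [Z + (A + B)]addrA [Z + A + _ + B]addrAC [Z + A + B + _ + _]addrAC.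
Qed.

Lemma solve_continuous_init u T : continuous u -> 0 <= T ->
  continuous (fun Z => solve u Z T).
Proof.
move=> cu T0 Z; have [U U0 uU] := bounded_noise T cu.
(* [C] bounds the squared norm on the unit ball around [Z]. *)
pose C := sqnorm Z * 2 + 4.
pose N := 2 * ((C + growth_const alpha beta a b U * T) *
       expR (2 * lin_const alpha beta * T)) + 2 * U.
have bN Z' : sqnorm Z' <= C -> apriori_bound alpha beta a b Z' U T <= N.
  by move=> ?; rewrite /apriori_bound lerD2r ler_pM2l// ler_wpM2r ?expR_ge0// lerD2r.
have C0 : 0 <= C by rewrite addr_ge0// mulr_ge0// sqnorm_ge0.
have N0 : 0 <= N.
  by rewrite addr_ge0 ?mulr_ge0 ?expR_ge0// addr_ge0// mulr_ge0// growth_const_ge0.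
have [L L0 hL] := @drift_stability _ alpha beta a b a_gt0 u T U N U0 N0 uU.
have ZN : apriori_bound alpha beta a b Z U T <= N.
  by apply: bN; rewrite /C; have := sqnorm_ge0 Z; lra.
apply/cvgrPdist_le => e e0.
pose k := expR (4 * L * T).
have k1 : 1 <= k by rewrite -expR0 ler_expR !mulr_ge0// ltW.
have near1 : \forall Z' \near Z, `|Z - Z'| <= Num.min 1 (e / (2 * k)).
  move/cvgrPdist_le : (@cvg_id _ (nbhs Z)); apply.
  by rewrite lt_min ltr01 divr_gt0// mulr_gt0// (lt_le_trans ltr01).
apply: filterS near1 => Z'; rewrite le_min => /andP[Z1 Ze].
have ZN' : apriori_bound alpha beta a b Z' U T <= N.
  apply: bN; have := sqnorm_le_sub Z' (Z' - Z); rewrite subKr.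
  have : sqnorm (Z' - Z) <= 2.
    apply: (le_trans (sqnorm_le_norm _)); rewrite distrC.
    by have : `|Z - Z'| ^+ 2 <= 1; [rewrite expr_le1|lra].
  by rewrite /C; lra.
have TT : 0 <= T <= T by rewrite T0 lexx.
have := hL _ _ _ _ ZN ZN' (solve_solution Z T cu) (solve_solution Z' T cu) T TT.
rewrite -/k => h.
rewrite -(@ler_sqr _ _ e) ?nnegrE ?(ltW e0)//.
apply: (le_trans (norm_le_sqnorm _)); apply: (le_trans h).
have k0 : 0 < k by rewrite (lt_le_trans ltr01).
apply: (@le_trans _ _ (2 * (e / (2 * k)) ^+ 2 * k)).
  rewrite ler_pM2r//; apply: (le_trans (sqnorm_le_norm _)).
  have r0 : 0 <= e / (2 * k) by rewrite divr_ge0 ?mulr_ge0 ?ltW.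
  by rewrite ler_pM2l// lerXn2r ?nnegrE.
rewrite (_ : 2 * _ * k = e ^+ 2 / (2 * k)); last first.
  by field; rewrite gt_eqF.
rewrite ler_pdivrMr ?mulr_gt0// ler_peMr ?sqr_ge0//; lra.
Qed.

End existence.

(** * Measurable dependence on parameters *)

Section measurability.
Context {R : realType}.

Lemma measurable_nonneg : measurable [set s : R | 0 <= s].
Proof.
rewrite (_ : [set s | _] = `[0, +oo[%classic); first exact: measurable_itv.
by apply/seteqP; split => s /=; rewrite in_itv/= andbT.
Qed.

(** Sampling the time on the grid of step [1 / (n + 1)] gives functions that
are measurable on each of countably many strips and converge pointwise. *)
Lemma caratheodory_measurable d (X : measurableType d) (u : R -> X -> R) :
  (forall s, measurable_fun [set: X] (u s)) ->
  (forall x, continuous (u ^~ x)) ->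
  measurable_fun ([set s : R | 0 <= s] `*` [set: X]) (fun p => u p.1 p.2).
Proof.
move=> mu cu.
pose q n (s : R) : R := (Num.trunc (s * n.+1%:R))%:R / n.+1%:R.
apply: (@measurable_fun_cvg _ _ _ _ (fun n p => u (q n p.1) p.2)); last first.
  move=> -[s x] [/= s0 _].
  apply: (@cvg_comp _ _ _ (q ^~ s) (u ^~ x) _ (nbhs s)); last exact: cu.
  apply/cvgrPdist_lt => e e0; near=> n.
  have n0 : (0 : R) < n.+1%:R by [].
  have sn0 : 0 <= s * n.+1%:R by rewrite mulr_ge0.
  have /andP[h1 h2] := truncn_itv sn0.
  rewrite /q ger0_norm; last by rewrite subr_ge0 ler_pdivrMr.
  have : n.+1%:R^-1 < e by near: n; exact: (near_infty_natSinv_lt (PosNum e0)).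
  apply: le_lt_trans; rewrite lerBlDl -[X in _ + X]mul1r -mulrDl.
  by rewrite natr1 ler_pdivlMr// ltW.
move=> n; pose E k := [set p : R * X | p.1 \in `[k%:R / n.+1%:R, k.+1%:R / n.+1%:R[].
have n0 : (0 : R) < n.+1%:R by [].
have -> : [set s : R | 0 <= s] `*` [set: X] = \bigcup_k E k.
  apply/seteqP; split => [[s x] [/= s0 _]|[s x] [k _]].
    exists (Num.trunc (s * n.+1%:R)) => //=.
    have sn0 : 0 <= s * n.+1%:R by rewrite mulr_ge0.
    by rewrite /E/= in_itv/= ler_pdivrMr// ltr_pdivlMr// truncn_itv.
  rewrite /E/= in_itv/= => /andP[h _]; split=> //=.
  by apply: le_trans h; rewrite divr_ge0.
have mE k : measurable (E k).
  rewrite (_ : E k = `[k%:R / n.+1%:R, k.+1%:R / n.+1%:R[%classic `*` setT).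
    by apply: measurableX => //; exact: measurable_itv.
  by apply/seteqP; split => [p|p [] ].
apply/measurable_fun_bigcup => // k.
apply: (@eq_measurable_fun _ _ _ _ _ (fun p => u (k%:R / n.+1%:R) p.2)).
  move=> [s x]; rewrite inE /E/= in_itv/= => h; rewrite /q.
  suff -> : Num.trunc (s * n.+1%:R) = k by [].
  by apply: truncn_def; rewrite -ler_pdivrMr// -ltr_pdivlMr.
apply: measurable_funTS.
exact: (measurableT_comp (mu _) measurable_snd).
Unshelve. all: by end_near.
Qed.

(** The positive and negative parts are handled separately, because the
measurability part of Tonelli's theorem requires nonnegative integrands. *)
Lemma primitive_measurable d (X : measurableType d) (u : R -> X -> R) t :
  (forall s, measurable_fun [set: X] (u s)) ->
  (forall x, continuous (u ^~ x)) ->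
  measurable_fun [set: X] (fun x => primitive (u ^~ x) t).
Proof.
move=> mu cu.
have [t0|t0] := ltP t 0.
  rewrite (_ : (fun _ => _) = cst 0)//.
  by apply/funext => x; rewrite primitive_le0// ltW.
have mc := caratheodory_measurable mu cu.
pose D := [set: X] `*` `[0, t]%classic.
have mD : measurable D by apply: measurableX => //; exact: measurable_itv.
pose F (p : X * R) := (u p.2 p.1)%:E.
have mF : measurable_fun D F.
  apply/measurable_EFinP.
  have msw : measurable_fun [set: X * R] (fun p => (p.2, p.1)).
    by apply: measurable_fun_pair.
  have mpos : measurable ([set s : R | 0 <= s] `*` [set: X]).
    by apply: measurableX => //; exact: measurable_nonneg.
  apply: (@measurable_comp _ _ _ _ _ _ ([set s : R | 0 <= s] `*` [set: X])
    (fun p : R * X => u p.1 p.2) D (fun p : X * R => (p.2, p.1)) mpos _ mc).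
    by move=> _ [p [_ h] <-] /=; split => //=; move: h; rewrite /= in_itv/= => /andP[].
  exact: measurable_funTS.
have key (g : X * R -> \bar R) : measurable_fun D g -> (forall p, 0 <= g p)%E ->
    measurable_fun [set: X]
      (fun x => \int[lebesgue_measure]_(s in `[0%R, t]) g (x, s))%E.
  move=> mg g0.
  have := @measurable_fun_fubini_tonelli_F _ _ X _ R lebesgue_measure (g \_ D)
    ((measurable_restrictT g mD).1 mg).
  have p0 p : (0 <= (g \_ D) p)%E by rewrite patchE; case: ifP.
  move=> /(_ p0); apply: eq_measurable_fun => x _.
  rewrite /fubini_F [RHS]integral_mkcond; apply: eq_integral => s _.
  rewrite !patchE; congr (if _ then _ else _).
  by apply/idP/idP; rewrite !inE => //= -[].
have m1 := key _ (measurable_funepos mF) (fun p => funepos_ge0 F p).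
have m2 := key _ (measurable_funeneg mF) (fun p => funeneg_ge0 F p).
have := measurableT_comp (fine_measurable measurableT) (emeasurable_funB m1 m2).
apply: eq_measurable_fun => x _ /=; rewrite /primitive /Rintegral; congr fine.
rewrite [RHS]integralE; congr (_ - _)%E; apply: eq_integral => s _.
  by rewrite !funeposE.
by rewrite !funenegE.
Qed.

Lemma measurable_fst_comp d (X : measurableType d) (g : X -> R * R) :
  measurable_fun setT g -> measurable_fun setT (fun x => (g x).1).
Proof. by move=> mg; exact: (measurableT_comp measurable_fst mg). Qed.

Lemma measurable_snd_comp d (X : measurableType d) (g : X -> R * R) :
  measurable_fun setT g -> measurable_fun setT (fun x => (g x).2).
Proof. by move=> mg; exact: (measurableT_comp measurable_snd mg). Qed.

Lemma measurable_pairD d (X : measurableType d) (g h : X -> R * R) :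
  measurable_fun setT g -> measurable_fun setT h ->
  measurable_fun setT (fun x => g x + h x).
Proof.
move=> mg mh; apply: measurable_fun_pair; apply: measurable_funD.
- exact: measurable_fst_comp.
- exact: measurable_fst_comp.
- exact: measurable_snd_comp.
- exact: measurable_snd_comp.
Qed.

Lemma measurable_truncated_drift (alpha beta a b N : R) d (X : measurableType d)
    (g : X -> R * R) :
  measurable_fun setT g ->
  measurable_fun setT (fun x => truncated_drift alpha beta a b N (g x)).
Proof.
move=> mg; have m1 := measurable_fst_comp mg; have m2 := measurable_snd_comp mg.
have mc (c : R) (h : X -> R) : measurable_fun setT h ->
    measurable_fun setT (fun x => c * h x).
  by move=> mh; apply: measurable_funM.
have mm : measurable_fun setT (fun x => Num.min (sqnorm (g x)) N).
  apply: measurable_minr => //.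
  by apply: measurable_funD; apply: measurable_funX.
apply: measurable_fun_pair => /=; apply: measurable_funB.
- by apply: measurable_funB; exact: mc.
- by apply: measurable_funM => //; apply: measurable_funB; exact: mc.
- by apply: measurable_funD; exact: mc.
- by apply: measurable_funM => //; apply: measurable_funD; exact: mc.
Qed.

Lemma measurable_pair_cvg d (X : measurableType d) (g : nat -> X -> R * R)
    (h : X -> R * R) :
  (forall n, measurable_fun setT (g n)) ->
  (forall x, g ^~ x @ \oo --> h x) ->
  measurable_fun setT h.
Proof.
move=> mg gh.
rewrite (_ : h = fun x => ((h x).1, (h x).2)); last by apply/funext => x; case: (h x).
apply: measurable_fun_pair.
  apply: (@measurable_fun_cvg _ _ _ _ (fun n x => (g n x).1)).
    by move=> n; exact: measurable_fst_comp.
  by move=> x _; apply: (cvg_comp _ _ (gh x)); exact: cvg_fst.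
apply: (@measurable_fun_cvg _ _ _ _ (fun n x => (g n x).2)).
  by move=> n; exact: measurable_snd_comp.
by move=> x _; apply: (cvg_comp _ _ (gh x)); exact: cvg_snd.
Qed.

(** The measurable space [X] is arbitrary: it will be the product of the path
space and the plane, and the path space with the past sigma-algebra. *)
Lemma solve_measurable (alpha beta a b : R) (a_gt0 : 0 < a)
    d (X : measurableType d) (u : X -> R -> R * R) (Z : X -> R * R) :
  (forall x, continuous (u x)) ->
  (forall t, measurable_fun setT (u ^~ t)) ->
  measurable_fun setT Z ->
  forall t, measurable_fun setT (fun x => solve alpha beta a b (u x) (Z x) t).
Proof.
move=> cu mu mZ t.
have mpic k n s : measurable_fun setT (fun x =>
    picard (field_along alpha beta a b k (u x)) (Z x) n s).
  elim: n s => [//|n IH] s /=.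
  apply: measurable_pairD => //; apply: measurable_fun_pair.
    apply: (@primitive_measurable _ _ (fun r x => (field_along alpha beta a b k (u x) r
      (picard (field_along alpha beta a b k (u x)) (Z x) n r)).1)).
      move=> r; apply: measurable_fst_comp; apply: measurable_truncated_drift.
      exact: measurable_pairD.
    move=> x; apply: continuous_fst_comp; apply: field_along_continuous => //.
    by apply: continuous_picard => y; exact: field_along_continuous.
  apply: (@primitive_measurable _ _ (fun r x => (field_along alpha beta a b k (u x) r
      (picard (field_along alpha beta a b k (u x)) (Z x) n r)).2)).
    move=> r; apply: measurable_snd_comp; apply: measurable_truncated_drift.
    exact: measurable_pairD.
  move=> x; apply: continuous_snd_comp; apply: field_along_continuous => //.
  by apply: continuous_picard => y; exact: field_along_continuous.
have mt k : measurable_fun setT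
    (fun x => truncated_solve alpha beta a b k (u x) (Z x) t).
  apply: measurable_pairD => //.
  apply: (measurable_pair_cvg (fun n => mpic k n t)) => x.
  have [L L0 hL] := field_along_lipschitz alpha beta a b k.
  have Gc y := @field_along_continuous _ alpha beta a b k (u x) y (cu x).
  have [M hM] := picard_lim_dist L0 Gc (hL (u x)) (Z x) t.
  apply/cvgrPdist_le => e e0; have [n hn] := geometric_le_eps M e0.
  exists n => // m /= nm; apply: (le_trans (hM _ _ (lexx t))).
  apply: le_trans hn.
  have M0 : 0 <= M by have := hM 0%N t (lexx _); rewrite expr0 mulr1; apply: le_trans.
  by rewrite ler_wpM2l// ler_wiXn2l//; lra.
apply: (measurable_pair_cvg mt) => x.
have [K [_ hK]] := truncated_solve_stable alpha beta b a_gt0 (Z x) t (cu x).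
apply: (@cvg_near_cst _ _ _ _ _ _).
exists K => // k Kk /=; rewrite hK//; apply/esym.
apply: (@pair_lim_near_cst _ _ _ K) => j Kj; exact: hK.
Qed.

End measurability.

(** * The random dynamical system *)

Section clamp.
Context {R : realType}.
Implicit Types (s t : R).

Definition clamp (lo hi t : R) : R := Num.max lo (Num.min t hi).

Lemma clamp_id lo hi t : lo <= t <= hi -> clamp lo hi t = t.
Proof. by move=> /andP[t0 tT]; rewrite /clamp min_l// max_r. Qed.

Lemma clamp_itv lo hi t : lo <= hi -> lo <= clamp lo hi t <= hi.
Proof. by move=> h; rewrite /clamp le_max lexx/= ge_max h ge_min lexx orbT. Qed.

Lemma clamp_dist lo hi s t : `|clamp lo hi s - clamp lo hi t| <= `|s - t|.
Proof.
have main x y : x <= y -> `|clamp lo hi x - clamp lo hi y| <= `|x - y|.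
  move=> xy; rewrite !ler0_norm ?subr_le0//.
    by rewrite /clamp /Num.max /Num.min; do !case: ifPn; rewrite -?leNgt; lra.
  by rewrite /clamp /Num.max /Num.min; do !case: ifPn; rewrite -?leNgt; lra.
by have [/main//|/ltW/main] := leP s t; rewrite distrC [`|t - s|]distrC.
Qed.

Lemma continuous_clamp lo hi : continuous (clamp lo hi).
Proof.
move=> t; apply/cvgrPdist_le => e e0.
move/cvgrPdist_le : (@cvg_id _ (nbhs t)) => /(_ _ e0); apply: filterS => s.
exact: le_trans (clamp_dist _ _ _ _).
Qed.

End clamp.

Lemma measurable_pair_on (R : realType) d (X : measurableType d) (D : set X)
    (h : X -> R * R) : measurable D ->
  measurable_fun D (fun x => (h x).1) -> measurable_fun D (fun x => (h x).2) ->
  measurable_fun D h.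
Proof.
move=> mD m1 m2; apply/(measurable_restrictT h mD)/measurable_fun_pairP; split.
  have := (measurable_restrictT _ mD).1 m1; apply: eq_measurable_fun => x _ /=.
  by rewrite !patchE; case: ifP.
have := (measurable_restrictT _ mD).1 m2; apply: eq_measurable_fun => x _ /=.
by rewrite !patchE; case: ifP.
Qed.

Section path_space.
Context {R : realType}.
Implicit Types (w : Omega R) (s t : R).

Lemma continuous_bpath w : continuous (bpath w).
Proof. by have [] := bpathP w. Qed.

Lemma bpath0 w : bpath w 0 = 0.
Proof. by have [] := bpathP w. Qed.

Lemma measurable_of_open d (X : measurableType d) (g : X -> R) :
  (forall O : set R, open O -> measurable (g @^-1` O)) -> measurable_fun setT g.
Proof.
move=> H; apply: (measurability _ (RGenOpens.measurableE R)).
move=> _ [_ [x [y ->]] <-]; rewrite setTI; apply: H; exact: itv_open.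
Qed.

Lemma open_eval (t : R) (O : set (R * R)) : open O ->
  measurable [set w : Omega R | O (bpath w t)].
Proof.
move=> oO; apply: sub_sigma_algebra.
exists [set g : {compact-open, R -> (R * R)%type} | g @` [set t] `<=` O].
  by apply: compact_open_open => //; exact: compact_set1.
apply/seteqP; split => w /=; last by move=> Ow _ [_ -> <-].
by move=> /(_ _ (ex_intro2 _ _ t erefl erefl)).
Qed.

Lemma measurable_bpath t : measurable_fun setT (fun w : Omega R => bpath w t).
Proof.
apply/measurable_fun_pairP; split; apply: measurable_of_open => O oO /=.
  apply: (@open_eval t (fst @^-1` O)).
  by apply: open_comp => // x _; exact: cvg_fst.
apply: (@open_eval t (snd @^-1` O)).
by apply: open_comp => // x _; exact: cvg_snd.
Qed.

Lemma theta0 w : theta 0 w = w.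
Proof.
apply: val_inj; apply/funext => s.
by rewrite -/(bpath (theta 0 w) s) thetaE addr0 bpath0 subr0.
Qed.

Lemma thetaD s t w : theta s (theta t w) = theta (s + t) w.
Proof.
apply: val_inj; apply/funext => r.
rewrite -/(bpath _ r) -/(bpath (theta (s + t) w) r) !thetaE.
by rewrite opprB addrA subrK addrA.
Qed.

End path_space.

Section sde_flow.
Context {R : realType}.
Variables (alpha beta a b sigma : R).
Hypothesis a_gt0 : 0 < a.
Implicit Types (w : Omega R) (s t : R) (Z : R * R).

Definition noise w t : R * R := (sigma * (bpath w t).1, sigma * (bpath w t).2).

Definition flow t w Z : R * R := solve alpha beta a b (noise w) Z t.

Lemma continuous_noise w : continuous (noise w).
Proof.
have cw := @continuous_bpath _ w.
by apply: continuous_pair => t; apply: cvgM;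
  [exact: cvg_cst|exact: continuous_fst_comp|exact: cvg_cst|exact: continuous_snd_comp].
Qed.

Lemma noise0 w : noise w 0 = 0.
Proof. by rewrite /noise bpath0 /= mulr0. Qed.

Lemma noise_theta s t w : noise (theta s w) t = noise w (s + t) - noise w s.
Proof. by rewrite /noise thetaE [t + s]addrC; apply: pair_ext; rewrite /= mulrBr. Qed.

Lemma flow0 w Z : flow 0 w Z = Z.
Proof.
by rewrite /flow solve_le0//; [rewrite noise0 addr0|exact: continuous_noise].
Qed.

Lemma flow_cocycle s t w Z : 0 <= t -> 0 <= s ->
  flow (t + s) w Z = flow t (theta s w) (flow s w Z).
Proof.
move=> t0 s0; have nE : noise (theta s w) = (fun r => noise w (s + r) - noise w s).
  by apply/funext => r; rewrite noise_theta.
by rewrite /flow nE addrC (solve_flow _ _ _ a_gt0 _ (@continuous_noise w)).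
Qed.

Lemma flow_solution w Z T : 0 <= T ->
  is_solution (drift alpha beta a b) sigma w Z T (fun t => flow t w Z).
Proof.
move=> T0; have [cy ey] := solve_solution alpha beta b a_gt0 Z T (@continuous_noise w).
by split; [exact: continuous_subspaceT|exact: ey].
Qed.

(** A solution is only continuous on [[0, T]]; composed with the projection
onto that interval it becomes continuous on the line without changing the
equation. *)
Lemma flow_unique w Z T (psi : R -> R * R) : 0 <= T ->
  is_solution (drift alpha beta a b) sigma w Z T psi ->
  forall t, 0 <= t <= T -> psi t = flow t w Z.
Proof.
move=> T0 [cpsi epsi].
pose cl := clamp 0 T.
have clE t : 0 <= t <= T -> cl t = t by exact: clamp_id.
have clT t : 0 <= cl t <= T by exact: clamp_itv.
have ccl : continuous cl by exact: continuous_clamp.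
have sy : integral_solution (drift alpha beta a b) (noise w) Z T (psi \o cl).
  split.
    move=> t O nO; have clt : `[0, T]%classic (cl t) by rewrite /= in_itv/=.
    have h := (@subspace_continuousP _ _ _ psi).1 cpsi _ clt _ nO.
    have K : \forall s \near t, `[0, T]%classic (cl s) -> O (psi (cl s)) := ccl t _ h.
    suff : \forall s \near t, O (psi (cl s)) by [].
    by apply: filterS K => s; apply; rewrite /= in_itv/=.
  move=> t tT; rewrite /= clE// epsi//; congr (_ + _ + _).
  apply: integral0_eq => s /andP[s0 st] /=; rewrite clE// s0/=.
  by apply: le_trans st _; case/andP: tT.
move=> t tT; rewrite -[t in LHS]clE//.
exact: (solve_unique a_gt0 (@continuous_noise w) sy).
Qed.

Lemma continuous_flow t w : 0 <= t -> continuous (flow t w).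
Proof. exact/solve_continuous_init/continuous_noise. Qed.

Lemma flow_measurable_init t :
  measurable_fun setT (fun p : Omega R * (R * R) => flow t p.1 p.2).
Proof.
apply: (solve_measurable alpha beta b a_gt0 (u := fun p => noise p.1) (Z := snd)) => //.
  by move=> p; exact: continuous_noise.
move=> s; apply: measurable_fun_pair; apply: measurable_funM => //.
  apply: measurable_fst_comp; exact: (measurableT_comp (measurable_bpath s)).
apply: measurable_snd_comp; exact: (measurableT_comp (measurable_bpath s)).
Qed.

Lemma flow_measurable :
  measurable_fun (([set t : R | 0 <= t] `*` [set: Omega R]) `*` [set: R * R])
    (fun p => flow p.1.1 p.1.2 p.2).
Proof.
have cphi w Z : continuous (fun t => flow t w Z).
  by apply: continuous_solve => //; exact: continuous_noise.
have mphi t := @flow_measurable_init t.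
have m1 := @caratheodory_measurable R _ (Omega R * (R * R))%type
  (fun t p => (flow t p.1 p.2).1) (fun t => measurable_fst_comp (mphi t))
  (fun p => continuous_fst_comp (@cphi p.1 p.2)).
have m2 := @caratheodory_measurable R _ (Omega R * (R * R))%type
  (fun t p => (flow t p.1 p.2).2) (fun t => measurable_snd_comp (mphi t))
  (fun p => continuous_snd_comp (@cphi p.1 p.2)).
pose re (p : R * Omega R * (R * R)) := (p.1.1, (p.1.2, p.2)).
have mre : measurable_fun setT re.
  apply: measurable_fun_pair; last apply: measurable_fun_pair => //.
    exact: (measurableT_comp measurable_fst measurable_fst).
  exact: (measurableT_comp measurable_snd measurable_fst).
have mpos : measurable ([set s : R | 0 <= s] `*` [set: Omega R * (R * R)]).
  by apply: measurableX => //; exact: measurable_nonneg.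
have sub : re @` (([set t : R | 0 <= t] `*` [set: Omega R]) `*` [set: R * R])
    `<=` [set s : R | 0 <= s] `*` [set: Omega R * (R * R)].
  by move=> _ [[[t w] Z] [[/= t0 _] _] <-].
have M1 := measurable_comp mpos sub m1 (measurable_funTS mre).
have M2 := measurable_comp mpos sub m2 (measurable_funTS mre).
apply: measurable_pair_on; [|exact: M1|exact: M2].
by apply: measurableX => //; apply: measurableX => //; exact: measurable_nonneg.
Qed.

Lemma flow_rds : random_dynamical_system [set: Omega R] flow.
Proof.
split; first exact: flow_measurable.
  by move=> w x _; exact: flow0.
by move=> w x t s _; exact: flow_cocycle.
Qed.

End sde_flow.

(** * Compactness and countability in the plane *)

Section plane_topology.
Context {R : realType}.
Implicit Types (z c : R * R) (B e : R).

Lemma compact_box B : compact [set z : R * R | `|z| <= B].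
Proof.
have -> : [set z : R * R | `|z| <= B] = `[- B, B]%classic `*` `[- B, B]%classic.
  apply/seteqP; split => z /=; rewrite !in_itv/= norm_pair_le !ler_norml.
    by move/andP.
  by case=> -> ->.
by apply: compact_setX; exact: segment_compact.
Qed.

Lemma nbhs_norm_lt z e : 0 < e -> nbhs z [set y | `|y - z| < e].
Proof.
move=> e0; apply/nbhs_ballP; exists e => // y.
by rewrite -ball_normE /ball_/= distrC.
Qed.

(** Bolzano-Weierstrass, in the form in which all compactness arguments on
pullback images use it. *)
Lemma bounded_cluster (x : nat -> R * R) B : (forall n, `|x n| <= B) ->
  exists p, forall e N, 0 < e -> exists2 n, (N <= n)%N & `|x n - p| < e.
Proof.
move=> xB; have [|p [_ clp]] := @compact_box B (x @ \oo) _.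
  by exists 0%N => // n _ /=; exact: xB.
exists p => e N e0.
have n1 := nbhs_norm_lt p e0.
have n2 : (x @ \oo) [set z | exists2 n, (N <= n)%N & z = x n].
  by exists N => // n /= Nn; exists n.
by have [z [[n Nn ->] /= zp]] := clp _ _ n2 n1; exists n.
Qed.

Definition rational_point (k : nat) : R * R :=
  if unpickle k is Some q then (ratr q.1, ratr q.2) : R * R
  else 0.

Lemma rational_point_dense z e : 0 < e ->
  exists k, `|rational_point k - z| < e.
Proof.
move=> e0.
have aux (x : R) : exists q : rat, `|ratr q - x| < e.
  have xe : x - e < x + e by lra.
  have [q] := rat_in_itvoo xe; rewrite in_itv/= => /andP[h1 h2]; exists q.
  by rewrite ltr_norml; apply/andP; split; lra.
have [q1 h1] := aux z.1; have [q2 h2] := aux z.2.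
exists (pickle (q1, q2)); rewrite /rational_point pickleK /=.
by rewrite norm_pair_lt h1.
Qed.

Lemma norm_le_of_approx z e :
  (forall d, 0 < d -> exists2 y, `|y| <= e & `|y - z| < d) ->
  `|z| <= e.
Proof.
move=> H; apply/ler_addgt0Pr => d d0; have [y ye yz] := H _ d0.
rewrite -(subrK y z) addrC; apply: (le_trans (ler_normD _ _)).
by rewrite lerD// ltW// distrC.
Qed.

Lemma enorm_le z : enorm z <= 2 * `|z|.
Proof.
rewrite /enorm -[_ + _]/(sqnorm z).
have h : 0 <= 2 * `|z| by rewrite mulr_ge0.
rewrite -(ger0_norm h) -sqrtr_sqr ler_sqrt ?sqr_ge0//.
apply: (le_trans (sqnorm_le_norm z)).
by have := normr_ge0 z; nra.
Qed.

Lemma enorm_lt z : enorm z < 2 * `|z| + 1.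
Proof. by rewrite (le_lt_trans (enorm_le z))// ltrDl. Qed.

Lemma semi_dist_le (E F : set (R * R)) e : 0 <= e ->
  (forall x, E x -> exists2 y, F y & `|x - y| <= e) ->
  (0 <= semi_dist E F <= (2 * e)%:E)%E.
Proof.
move=> e0 H; apply/andP; split; first by apply: ereal_sup_ubound; left.
apply: ge_ereal_sup => _ [->|[x Ex <-]]; first by rewrite lee_fin mulr_ge0.
have [y Fy xy] := H _ Ex.
apply: (@le_trans _ _ (enorm (x - y))%:E).
  by apply: ereal_inf_lbound; exists y.
by rewrite lee_fin (le_trans (enorm_le _))// ler_pM2l.
Qed.

Lemma cvge_to_0 (T : Type) (F : set_system T) (FF : Filter F) (g : T -> \bar R) :
  (forall e, 0 < e -> \forall t \near F, (0 <= g t <= e%:E)%E) ->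
  g @ F --> 0%E.
Proof.
move=> H; apply/fine_cvgP; split.
  apply: filterS (H 1 ltr01) => t /andP[h1 h2].
  by rewrite ge0_fin_numE// (le_lt_trans h2)// ltry.
apply/cvgrPdist_le => e e0; apply: filterS (H _ e0) => t /andP[h1 h2] /=.
rewrite sub0r normrN ger0_norm ?fine_ge0// -lee_fin fineK//.
by rewrite ge0_fin_numE// (le_lt_trans h2)// ltry.
Qed.

Lemma measurable_norm_lt d (X : measurableType d) (g : X -> R * R) e :
  measurable_fun setT g -> measurable [set x | `|g x| < e].
Proof.
move=> mg.
have aux (h : X -> R) : measurable_fun setT h -> measurable [set x | `|h x| < e].
  move=> mh; have : measurable_fun setT (fun x => `|h x|).
    exact: measurableT_comp.
  move=> /(_ measurableT `]-oo, e[%classic (measurable_itv _)); rewrite setTI.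
  by congr measurable; apply/seteqP; split => x /=; rewrite in_itv.
rewrite (_ : [set x | _] = [set x | `|(g x).1| < e] `&` [set x | `|(g x).2| < e]).
  by apply: measurableI; apply: aux; [exact: measurable_fst_comp|exact: measurable_snd_comp].
apply/seteqP; split => x /=; rewrite norm_pair_lt; first by move/andP.
by case=> -> ->.
Qed.

End plane_topology.

(** * Oscillation of a path over the last unit of time *)

Section oscillation.
Context {R : realType}.
Implicit Types (w : Omega R) (s t : R).

Definition dyadic_time (n : nat) : R :=
  if unpickle n is Some (m, k) then clamp (-1) 0 (k%:R / 2 ^+ m - 1) else -1.

(** The supremum is taken over a countable set of times, so that it is
measurable; by continuity of the path, [le_osc] covers all times. *)
Definition osc w : R :=
  sups (fun n => `|bpath w (dyadic_time n) - bpath w (-1)|) 0.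

Lemma dyadic_bound (g : R -> R) (M : R) : continuous g ->
  (forall m k, (k <= 2 ^ m)%N -> g (k%:R / 2 ^+ m) <= M) ->
  forall t, 0 <= t <= 1 -> g t <= M.
Proof.
move=> cg gM t /andP[t0 t1].
pose q (m : nat) : R := (Num.trunc (t * 2 ^+ m))%:R / 2 ^+ m.
have qt : q @ \oo --> t.
  apply/cvgrPdist_le => e e0; have [n hn] := @geometric_le_eps R 1 e e0.
  exists n => // m /= nm.
  have p0 : (0 : R) < 2 ^+ m by rewrite exprn_gt0.
  have tp0 : 0 <= t * 2 ^+ m by rewrite mulr_ge0// ltW.
  have /andP[h1 h2] := truncn_itv tp0.
  rewrite /q ger0_norm; last by rewrite subr_ge0 ler_pdivrMr.
  apply: (@le_trans _ _ (2 ^+ m)^-1).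
    by rewrite lerBlDl -[X in _ + X]mul1r -mulrDl natr1 ler_pdivlMr// ltW.
  apply: le_trans hn; rewrite mul1r exprVn lef_pV2 ?posrE ?exprn_gt0//.
  by rewrite ler_weXn2l// ler1n.
have gq : g \o q @ \oo --> g t by apply: (cvg_comp _ _ qt); exact: cg.
rewrite -(cvg_lim (@Rhausdorff R) gq); apply: limr_le.
  by apply/cvg_ex; exists (g t).
apply: nearW => m; apply: gM; rewrite truncn_le_nat.
have -> : (2 ^ m).+1%:R = 2 ^+ m + 1 :> R by rewrite -[LHS]natr1 natrX.
by rewrite (@le_lt_trans _ _ (2 ^+ m))// ?ltrDl// ler_piMl// exprn_ge0.
Qed.

Lemma dyadic_time_itv n : -1 <= dyadic_time n <= 0.
Proof.
by rewrite /dyadic_time; case: unpickle => [[m k]|];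
  [apply: clamp_itv; rewrite lerN10|rewrite lexx lerN10].
Qed.

Lemma continuous_increment w s :
  continuous (fun t => `|bpath w t - bpath w s|).
Proof.
by move=> t; apply: cvg_norm; apply: cvgB; [exact: continuous_bpath|exact: cvg_cst].
Qed.

Lemma osc_has_ubound w :
  has_ubound (range (fun n => `|bpath w (dyadic_time n) - bpath w (-1)|)).
Proof.
have cs : {within `[-1, 0], continuous (fun t => `|bpath w t - bpath w (-1)|)}.
  by apply: continuous_subspaceT; exact: continuous_increment.
have [c _ hc] := EVT_max (lerN10 R) cs.
eexists => _ [n _ <-]; apply: hc; rewrite in_itv/=; exact: dyadic_time_itv.
Qed.

Lemma oscE w :
  osc w = sup (range (fun n => `|bpath w (dyadic_time n) - bpath w (-1)|)).
Proof.
rewrite /osc /sups /= /sdrop; congr sup; apply/seteqP; split => x [n _ <-];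
  by exists n.
Qed.

Lemma le_osc w s : -1 <= s <= 0 -> `|bpath w s - bpath w (-1)| <= osc w.
Proof.
move=> s1; pose g r := `|bpath w (r - 1) - bpath w (-1)|.
have cg : continuous g.
  move=> r; apply: cvg_norm; apply: cvgB; last exact: cvg_cst.
  apply: (@continuous_comp _ _ _ (fun r : R => r - 1) (bpath w)).
    by apply: cvgB; [exact: cvg_id|exact: cvg_cst].
  exact: continuous_bpath.
have := @dyadic_bound g (osc w) cg _ (s + 1).
rewrite /g addrK; apply; last by lra.
move=> m k km; rewrite oscE; apply: ub_le_sup; first exact: osc_has_ubound.
exists (pickle (m, k)) => //; rewrite /dyadic_time pickleK clamp_id//.
have p0 : (0 : R) < 2 ^+ m by rewrite exprn_gt0.
have h1 : 0 <= k%:R / 2 ^+ m :> R by rewrite divr_ge0// ltW.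
have h2 : k%:R / 2 ^+ m <= 1 :> R by rewrite ler_pdivrMr// mul1r -natrX ler_nat.
by lra.
Qed.

Lemma osc_le w M :
  (forall s, -1 <= s <= 0 -> `|bpath w s - bpath w (-1)| <= M) ->
  osc w <= M.
Proof.
move=> H; rewrite oscE; apply: ge_sup.
  by exists `|bpath w (dyadic_time 0) - bpath w (-1)|, 0%N.
by move=> _ [n _ <-]; apply: H; exact: dyadic_time_itv.
Qed.

Lemma osc_ge0 w : 0 <= osc w.
Proof. by apply: le_trans (@le_osc w 0 _) => //; rewrite lerN10 lexx. Qed.

Lemma measurable_osc : measurable_fun setT osc.
Proof.
apply: measurable_fun_sups => [w _|n]; first exact: osc_has_ubound.
have mB : measurable_fun setT (fun w => bpath w (dyadic_time n) - bpath w (-1)).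
  have m1 := @measurable_bpath R (dyadic_time n).
  have m2 := @measurable_bpath R (-1).
  apply: measurable_fun_pair; apply: measurable_funB.
  - exact: (measurable_fst_comp m1).
  - exact: (measurable_fst_comp m2).
  - exact: (measurable_snd_comp m1).
  - exact: (measurable_snd_comp m2).
rewrite (_ : (fun w => _) = (fun w => Num.max
  `|(bpath w (dyadic_time n) - bpath w (-1)).1|
  `|(bpath w (dyadic_time n) - bpath w (-1)).2|)); last first.
  by apply/funext => w; rewrite prod_normE.
apply: measurable_maxr; apply: measurableT_comp => //.
  exact: (measurable_fst_comp mB).
exact: (measurable_snd_comp mB).
Qed.

End oscillation.

(** * The pullback attractor *)

Section attractor.
Context {R : realType}.
Variables (alpha beta a b sigma : R).
Hypothesis a_gt0 : 0 < a.
Implicit Types (w : Omega R) (s t : R) (Z : R * R).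

Local Notation flow := (flow alpha beta a b sigma).

(** The state at time [0] of the system driven by [w] and started from [Z] at
time [- s]. *)
Definition pullback s w Z : R * R := flow s (theta (- s) w) Z.

Lemma pullback_flow s t w Z : 0 <= s -> 0 <= t ->
  pullback (t + s) (theta t w) Z = flow t w (pullback s w Z).
Proof.
move=> s0 t0; rewrite /pullback thetaD opprD addrAC addNr add0r.
by rewrite flow_cocycle// thetaD subrr theta0.
Qed.

(** The images of the plane under [pullback s w] decrease in [s]. *)
Lemma pullback_range s t w Z : 0 <= s -> s <= t ->
  exists Z', pullback t w Z = pullback s w Z'.
Proof.
move=> s0 st; exists (flow (t - s) (theta (- t) w) Z).
have ts0 : 0 <= t - s by rewrite subr_ge0.
have := @flow_cocycle _ alpha beta a b sigma a_gt0 (t - s) s (theta (- t) w) Z s0 ts0.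
by rewrite thetaD addrAC subrr add0r addrC subrK.
Qed.

Lemma continuous_pullback s w : 0 <= s -> continuous (pullback s w).
Proof. by move=> s0; exact: continuous_flow. Qed.

Lemma pullback_rational s w Z c e : 0 <= s -> `|pullback s w Z - c| < e ->
  exists k, `|pullback s w (rational_point k) - c| < e.
Proof.
move=> s0 Zc; have d0 : 0 < e - `|pullback s w Z - c| by rewrite subr_gt0.
have /cvgrPdist_lt/(_ _ d0) := @continuous_pullback s w s0 Z.
move=> /nbhs_ballP[r /= r0 hr].
have [k hk] := @rational_point_dense R Z r r0.
exists k; have := hr (rational_point k).
rewrite -ball_normE /ball_/= distrC hk => /(_ isT); rewrite distrC => h.
rewrite -(subrK (pullback s w Z) (pullback s w _)) -addrA.
by apply: (le_lt_trans (ler_normD _ _)); rewrite -ltrBrDr.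
Qed.

(** The noise on [[0, s]] seen from time [- s] consists of increments of the
path between [- s] and [0].  Stopping it outside of that interval does not
change the solution at time [s] and leaves only these increments. *)
Lemma pullback_measurable d (X : measurableType d) (om : X -> Omega R) s Z :
  0 <= s ->
  (forall t, - s <= t <= 0 ->
    measurable_fun setT (fun x => bpath (om x) t - bpath (om x) (- s))) ->
  measurable_fun setT (fun x => pullback s (om x) Z).
Proof.
move=> s0 minc.
pose u (x : X) (t : R) : R * R := noise sigma (theta (- s) (om x)) (clamp 0 s t).
have cu x : continuous (u x).
  move=> t; apply: (@continuous_comp _ _ _ (clamp 0 s)
    (noise sigma (theta (- s) (om x)))).
    exact: continuous_clamp.
  exact: continuous_noise.
have uE x t : 0 <= t <= s -> noise sigma (theta (- s) (om x)) t = u x t.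
  by move=> ts; rewrite /u clamp_id.
rewrite (_ : (fun x => _) = (fun x => solve alpha beta a b (u x) Z s)); last first.
  apply/funext => x; rewrite /pullback /flow.
  apply: (solve_local alpha beta b a_gt0 Z (@continuous_noise _ sigma _) (cu x) (uE x)).
  by rewrite s0 lexx.
apply: solve_measurable => // t.
have ts : - s <= clamp 0 s t - s <= 0.
  by have /andP[h1 h2] := clamp_itv t s0; rewrite lerBrDl subrr h1 lerBlDr add0r.
have m := minc _ ts.
apply: measurable_fun_pair => /=; apply: measurable_funM => //.
  exact: (measurable_fst_comp m).
exact: (measurable_snd_comp m).
Qed.

Definition noise_bound (S : R) := 2 * (`|sigma| * S) ^+ 2.

(** The bound of [coming_down_from_infinity], transferred from [y - u] to [y]
and from [|y|^2] to [|y|] (by [|y| <= |y|^2 + 1]). *)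
Definition radius (S : R) :=
  2 * (16 / a + damping_const alpha beta a b (noise_bound S)) + 2 * noise_bound S + 1.

Lemma pullback1_bound w Z : `|pullback 1 w Z| <= radius (osc w).
Proof.
set U := noise_bound (osc w).
have uU t : 0 <= t <= 1 -> sqnorm (noise sigma (theta (- 1) w) t) <= U.
  move=> t1; apply: (le_trans (sqnorm_le_norm _)); rewrite ler_pM2l//.
  rewrite lerXn2r ?nnegrE// ?mulr_ge0 ?osc_ge0//.
  have h : `|bpath (theta (- 1) w) t| <= osc w.
    by rewrite thetaE le_osc//; lra.
  rewrite norm_pair_le /= !normrM !ler_wpM2l//.
    exact: le_trans (norm_snd _) h.
  exact: le_trans (norm_fst _) h.
have sol := solve_solution alpha beta b a_gt0 Z 1
  (@continuous_noise R sigma (theta (- 1) w)).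
have h1 := coming_down_from_infinity a_gt0 uU sol.
rewrite -[solve _ _ _ _ _ _ _]/(pullback 1 w Z) in h1.
have h2 := sqnorm_le_sub (pullback 1 w Z) (noise sigma (theta (- 1) w) 1).
have h3 := uU 1; rewrite ler01 lexx in h3; have {}h3 := h3 isT.
have h4 := norm_le_sqnorm (pullback 1 w Z).
have h5 : `|pullback 1 w Z| <= `|pullback 1 w Z| ^+ 2 + 1.
  by have := sqr_ge0 (`|pullback 1 w Z| - 1); have := normr_ge0 (pullback 1 w Z); nra.
by rewrite /radius -/U; lra.
Qed.

Lemma pullback_bound s w Z : 1 <= s -> `|pullback s w Z| <= radius (osc w).
Proof.
by move=> s1; have [Z' ->] := @pullback_range 1 s w Z ler01 s1; exact: pullback1_bound.
Qed.

(** The intersection of the closures of the pullback images of the plane, at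
integer times and with matching tolerances: a countable condition. *)
Definition attractor : set (Omega R * (R * R)) :=
  [set p | forall n : nat, exists Z, `|pullback n.+1%:R p.1 Z - p.2| < n.+1%:R^-1].

Lemma attractorP w x : xsection attractor w x <->
  forall s e, 0 <= s -> 0 < e -> exists Z, `|pullback s w Z - x| < e.
Proof.
rewrite /xsection /= in_setE; split=> [Ax s e s0 e0|H n /=]; last first.
  by apply: H => //; rewrite invr_gt0.
(* This choice gives [s <= n + 1] and [1 / (n + 1) <= e]. *)
pose n := maxn (Num.trunc s) (Num.trunc e^-1).
have [Z] := Ax n => /= h.
have sn : s <= n.+1%:R.
  apply: (le_trans (ltW (truncnS_gt s))); rewrite ler_nat ltnS; exact: leq_maxl.
have en : n.+1%:R^-1 <= e.
  rewrite -[leRHS]invrK lef_pV2 ?posrE ?invr_gt0//.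
  by apply: (le_trans (ltW (truncnS_gt _))); rewrite ler_nat ltnS; exact: leq_maxr.
have [Z' eZ] := @pullback_range s n.+1%:R w Z s0 sn.
by exists Z'; rewrite -eZ (lt_le_trans h).
Qed.

Lemma attractor_bound w x : xsection attractor w x -> `|x| <= radius (osc w).
Proof.
move/attractorP => Ax; apply: norm_le_of_approx => d d0.
have [Z hZ] := Ax 1 d ler01 d0; exists (pullback 1 w Z) => //.
exact: pullback1_bound.
Qed.

Lemma attractor_compact w : compact (xsection attractor w).
Proof.
apply: (subclosed_compact _ (@compact_box R (radius (osc w)))); last first.
  by move=> x /attractor_bound.
move=> x clx; apply/attractorP => s e s0 e0.
have e2 : 0 < e / 2 by rewrite divr_gt0.
have [y [/attractorP/(_ s (e / 2) s0 e2)[Z hZ] /= xy]] := clx _ (nbhs_norm_lt x e2).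
exists Z; rewrite -(subrK y (pullback s w Z)) -addrA.
by apply: (le_lt_trans (ler_normD _ _)); rewrite (splitr e) ltrD.
Qed.

Lemma cluster_attractor w (x : nat -> R * R) p :
  (forall n, exists Z, x n = pullback n.+1%:R w Z) ->
  (forall e N, 0 < e -> exists2 n, (N <= n)%N & `|x n - p| < e) ->
  xsection attractor w p.
Proof.
move=> xn clp; apply/attractorP => s e s0 e0.
have [n Nn hn] := clp e (Num.trunc s) e0; have [Z xnE] := xn n.
have sn : s <= n.+1%:R.
  by apply: (le_trans (ltW (truncnS_gt s))); rewrite ler_nat ltnS.
have [Z' eZ] := @pullback_range s n.+1%:R w Z s0 sn.
by exists Z'; rewrite -eZ -xnE.
Qed.

(** Points chosen in the pullback images have a cluster point, and it lies on
the attractor because the images decrease. *)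
Lemma pullback_cluster w (x : nat -> R * R) :
  (forall n, exists Z, x n = pullback n.+1%:R w Z) ->
  exists2 p, xsection attractor w p &
    forall e N, 0 < e -> exists2 n, (N <= n)%N & `|x n - p| < e.
Proof.
move=> xn; have [n|p clp] := @bounded_cluster R x (radius (osc w)).
  by have [Z ->] := xn n; apply: pullback_bound; rewrite ler1n.
by exists p => //; exact: (cluster_attractor xn clp).
Qed.

(** Otherwise some points of the images at all integer times would keep the
distance [e] from the attractor, and so would their cluster point. *)
Lemma attractor_attracts w e : 0 < e ->
  exists N : nat, forall s Z, N%:R <= s ->
    exists2 y, xsection attractor w y & `|pullback s w Z - y| <= e.
Proof.
move=> e0; apply: contrapT => /forallNP H.
have {}H n : exists Z, forall y, xsection attractor w y ->
    e < `|pullback n.+1%:R w Z - y|.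
  have /existsNP[s /existsNP[Z]] := H n.+1.
  move=> /not_implyP[ns h].
  have [Z' eZ] := @pullback_range n.+1%:R s w Z (ler0n _ _) ns.
  exists Z' => y Ay; rewrite ltNge; apply/negP => le; apply: h.
  by exists y => //; rewrite eZ.
have [Z hZ] := choice H.
have [p Ap clp] := @pullback_cluster w (fun n => pullback n.+1%:R w (Z n))
  (fun n => ex_intro _ (Z n) erefl).
have [n _ hn] := clp e 0%N e0.
by have := hZ n p Ap; rewrite ltNge ltW.
Qed.

(** Invariance of the images passes to the intersection of the closures: one
inclusion by continuity of the flow, the other by extracting a cluster point
of approximate preimages. *)
Lemma attractor_invariant w t : 0 <= t ->
  flow t w @` xsection attractor w = xsection attractor (theta t w).
Proof.
move=> t0; apply/seteqP; split=> [_ [x Ax <-]|y Ay].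
  apply/attractorP => s e s0 e0.
  have /cvgrPdist_lt/(_ _ e0)/nbhs_ballP[d /= d0 hd] :=
    @continuous_flow R alpha beta a b sigma a_gt0 t w t0 x.
  have /attractorP/(_ s d s0 d0)[Z hZ] := Ax.
  have h : `|flow t w x - flow t w (pullback s w Z)| < e.
    by apply: hd; rewrite -ball_normE /ball_/= distrC.
  have st : s <= t + s by rewrite lerDr.
  have [Z' eZ] := @pullback_range s (t + s) (theta t w) Z s0 st.
  by exists Z'; rewrite -eZ (pullback_flow _ _ s0 t0) distrC.
have H n : exists Z, `|pullback (t + n.+1%:R) (theta t w) Z - y| < n.+1%:R^-1.
  by move/attractorP : Ay; apply; rewrite ?addr_ge0 ?invr_gt0.
have [Z hZ] := choice H.
have [p Ap clp] := @pullback_cluster w (fun n => pullback n.+1%:R w (Z n))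
  (fun n => ex_intro _ (Z n) erefl).
exists p => //; apply/eqP; rewrite -subr_eq0 -normr_le0.
apply/ler_addgt0Pr => e e0; rewrite add0r.
have e2 : 0 < e / 2 by rewrite divr_gt0.
have /cvgrPdist_lt/(_ _ e2)/nbhs_ballP[d /= d0 hd] :=
    @continuous_flow R alpha beta a b sigma a_gt0 t w t0 p.
have [n Nn hn] := clp d (Num.trunc (e / 2)^-1) d0.
have h : `|flow t w p - flow t w (pullback n.+1%:R w (Z n))| < e / 2.
  by apply: hd; rewrite -ball_normE /ball_/= distrC.
have h' := hZ n; rewrite pullback_flow// in h'.
have en : n.+1%:R^-1 <= e / 2.
  rewrite -[leRHS]invrK lef_pV2 ?posrE ?invr_gt0//.
  by apply: (le_trans (ltW (truncnS_gt _))); rewrite ler_nat ltnS.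
rewrite -(subrK (flow t w (pullback n.+1%:R w (Z n))) (flow t w p)) -addrA.
apply: (le_trans (ler_normD _ _)); rewrite (splitr e) lerD ?(ltW h)//.
exact: le_trans (ltW h') en.
Qed.

(** For a decreasing family of relatively compact images, coming arbitrarily
close to a closed box is the same as having a limit point in it. *)
Lemma attractor_hits_box w c r : 0 <= r ->
  (exists2 x, xsection attractor w x & `|x - c| <= r) <->
  forall n : nat, exists k,
    `|pullback n.+1%:R w (rational_point k) - c| < r + n.+1%:R^-1.
Proof.
move=> r0; split=> [[x Ax xc] n|H].
  have i0 : (0 : R) < n.+1%:R^-1 by rewrite invr_gt0.
  have /attractorP/(_ n.+1%:R _ (ler0n _ _) i0)[Z hZ] := Ax.
  apply: (@pullback_rational _ _ Z) => //.
  rewrite -(subrK x (pullback _ _ _)) -addrA.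
  by apply: (le_lt_trans (ler_normD _ _)); rewrite [ltRHS]addrC ltr_leD.
have [k hk] := choice H.
have [p Ap clp] := @pullback_cluster w
  (fun n => pullback n.+1%:R w (rational_point (k n)))
  (fun n => ex_intro _ (rational_point (k n)) erefl).
exists p => //; apply/ler_addgt0Pr => e e0.
have e2 : 0 < e / 2 by rewrite divr_gt0.
have [n Nn hn] := clp (e / 2) (Num.trunc (e / 2)^-1) e2.
have en : n.+1%:R^-1 <= e / 2.
  rewrite -[leRHS]invrK lef_pV2 ?posrE ?invr_gt0//.
  by apply: (le_trans (ltW (truncnS_gt _))); rewrite ler_nat ltnS.
rewrite -(subrK (pullback n.+1%:R w (rational_point (k n))) p) -addrA.
apply: (le_trans (ler_normD _ _)); rewrite distrC.
rewrite (splitr e) [leRHS]addrCA lerD ?(ltW hn)// (le_trans (ltW (hk n)))//.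
by rewrite lerD2l.
Qed.

Lemma measurable_attractor : measurable attractor.
Proof.
rewrite (_ : attractor = \bigcap_n \bigcup_k
  [set p : Omega R * (R * R) |
    `|pullback n.+1%:R p.1 (rational_point k) - p.2| < n.+1%:R^-1]).
  apply: bigcapT_measurable => n; apply: bigcupT_measurable => k.
  apply: measurable_norm_lt.
  have m : measurable_fun setT (fun p : Omega R * (R * R) =>
      pullback n.+1%:R p.1 (rational_point k)).
    apply: (pullback_measurable _ (om := fst)) => // t _.
    have mb s : measurable_fun setT (fun p : Omega R * (R * R) => bpath p.1 s).
      exact: (measurableT_comp (measurable_bpath s) measurable_fst).
    apply: measurable_fun_pair; apply: measurable_funB.
    - exact: (measurable_fst_comp (mb t)).
    - exact: (measurable_fst_comp (mb _)).
    - exact: (measurable_snd_comp (mb t)).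
    - exact: (measurable_snd_comp (mb _)).
  have m2 := @measurable_snd _ _ (Omega R) (R * R)%type.
  apply: measurable_fun_pair; apply: measurable_funB.
  - exact: (measurable_fst_comp m).
  - exact: (measurable_fst_comp m2).
  - exact: (measurable_snd_comp m).
  - exact: (measurable_snd_comp m2).
apply/seteqP; split=> [p Ap n _|p H n /=].
  have [Z hZ] := Ap n.
  by have [k hk] := pullback_rational (ler0n _ _) hZ; exists k.
by have [k _ hk] := H n I; exists (rational_point k).
Qed.

(** An open set is a countable union of closed boxes with rational centres, so
that hitting it reduces to [attractor_hits_box]. *)
Lemma attractor_past : measurable_multifunction (past 0) (xsection attractor).
Proof.
move=> U oU.
pose gens : set (set (Omega R)) := [set E | exists (u v : R) (B : set (R * R)),
        [/\ v <= u, u <= 0, measurable B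
          & E = [set w | B (bpath w u - bpath w v)]]].
pose X := g_sigma_algebraType gens.
have mpull n Z : measurable_fun setT (fun w : X => pullback n.+1%:R w Z).
  apply: (pullback_measurable _ (om := fun w : X => w : Omega R)) => // t /andP[t1 t2].
  move=> _ B mB; rewrite setTI; apply: sub_sigma_algebra.
  by exists t, (- n.+1%:R), B.
have mbox c r : 0 <= r -> measurable ([set w | exists2 x, xsection attractor w x &
    `|x - c| <= r] : set X).
  move=> r0.
  rewrite (_ : [set w | _] = \bigcap_n \bigcup_k
    [set w : X | `|pullback n.+1%:R w (rational_point k) - c| < r + n.+1%:R^-1]).
    apply: bigcapT_measurable => n; apply: bigcupT_measurable => k.
    apply: measurable_norm_lt; have m := mpull n (rational_point k).
    apply: measurable_fun_pair; apply: measurable_funB => //.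
      exact: (measurable_fst_comp m).
    exact: (measurable_snd_comp m).
  apply/seteqP; split=> [w /(attractor_hits_box _ _ r0) H n _|w H].
    by have [k hk] := H n; exists k.
  apply/(attractor_hits_box _ _ r0) => n.
  by have [k _ hk] := H n I; exists k.
pose inU (c : R * R) (r : R) := forall x, `|x - c| <= r -> U x.
pose piece (q : nat * nat) : set X :=
  [set w | inU (rational_point q.1) q.2.+1%:R^-1 /\
    exists2 x, xsection attractor w x & `|x - rational_point q.1| <= q.2.+1%:R^-1].
rewrite (_ : [set w | _] = \bigcup_i (if unpickle i is Some q then piece q else set0)).
  apply: (@bigcupT_measurable _ X) => i; case: unpickle => [q|];
    last exact: measurable0.
  have [h|h] := pselect (inU (rational_point q.1) q.2.+1%:R^-1).
    rewrite (_ : piece q = [set w | exists2 x, xsection attractor w x &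
       `|x - rational_point q.1| <= q.2.+1%:R^-1]); first exact: mbox.
    by apply/seteqP; split => w /=; [case|split].
  rewrite (_ : piece q = set0); first exact: measurable0.
  by apply/seteqP; split => w //= [].
apply/seteqP; split=> [w [x [Ax Ux]]|w [i _]]; last first.
  case: unpickle => // q [h [x Ax xq]]; exists x; split => //; exact: h.
have /nbhs_ballP[e /= e0 he] : nbhs x U by exact: open_nbhs_nbhs.
pose j := Num.trunc (e / 2)^-1.
have ej : j.+1%:R^-1 < e / 2.
  rewrite -[ltRHS]invrK ltf_pV2 ?posrE ?invr_gt0 ?divr_gt0//; exact: truncnS_gt.
have i0 : (0 : R) < j.+1%:R^-1 by rewrite invr_gt0.
have [k hk] := @rational_point_dense R x _ i0.
exists (pickle (k, j)) => //; rewrite pickleK; split; last first.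
  by exists x => //; rewrite distrC ltW.
move=> y /= yk; apply: he; rewrite -ball_normE /ball_/=.
rewrite -(subrK (rational_point k) x) -addrA.
apply: (le_lt_trans (ler_normD _ _)); rewrite distrC (splitr e) ltrD ?(lt_trans hk)//.
by rewrite distrC (le_lt_trans yk).
Qed.

End attractor.

(** * Gaussian tails and dyadic chaining *)

Lemma measurable_norm_ge (R : realType) d (X : measurableType d) (g : X -> R)
    (l : R) : measurable_fun setT g -> measurable [set x | l <= `|g x|].
Proof.
move=> mg; have mn : measurable_fun setT (fun x => `|g x|).
  exact: measurableT_comp.
have := mn measurableT `[l, +oo[%classic (measurable_itv _); rewrite setTI.
by congr measurable; apply/seteqP; split => x /=; rewrite in_itv/= andbT.
Qed.

Section normal_tail.
Context {R : realType}.
Implicit Types (s l x : R).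

(** From [1 + x / 2 <= exp (x / 2)]. *)
Lemma expR_le_sqr x : 0 < x -> expR (- x) <= 4 / x ^+ 2.
Proof.
move=> x0; rewrite expRN -[leRHS]invrK lef_pV2 ?posrE ?expR_gt0//; last first.
  by rewrite invr_gt0 divr_gt0// exprn_gt0.
rewrite invf_div; have h := expR_ge1Dx (x / 2).
have -> : expR x = expR (x / 2) ^+ 2 by rewrite expr2 -expRD -splitr.
have h2 : (1 + x / 2) ^+ 2 <= expR (x / 2) ^+ 2.
  by rewrite lerXn2r ?nnegrE ?expR_ge0// addr_ge0// divr_ge0// ltW.
apply: le_trans h2; rewrite -subr_ge0 (_ : _ - _ = 1 + x); last by field.
by rewrite addr_ge0// ltW.
Qed.

Lemma normal_peak_le s : 0 < s ->
  normal_peak s <= 2 * normal_peak (Num.sqrt 2 * s).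
Proof.
move=> s0; rewrite /normal_peak exprMn sqr_sqrtr//.
set X := s ^+ 2 * pi *+ 2.
have X0 : 0 < X by rewrite mulrn_wgt0// mulr_gt0 ?pi_gt0// exprn_gt0.
have -> : 2 * s ^+ 2 * pi *+ 2 = 2 * X by rewrite /X; ring.
rewrite sqrtrM// invfM mulrA ler_peMl ?invr_ge0 ?sqrtr_ge0//.
rewrite ler_pdivlMr ?sqrtr_gt0// mul1r -[leRHS]ger0_norm// -sqrtr_sqr.
by rewrite ler_sqrt// expr2; lra.
Qed.

(** Half of the exponent is spent on the decay, and the other half is the
exponent of the centred normal density of variance [2 s^2], whose total mass
is [1]. *)
Lemma normal_pdf_tail s l x : 0 < s -> 0 < l -> l <= `|x| ->
  normal_pdf 0 s x <=
  128 * (s / l) ^+ 4 * normal_pdf 0 (Num.sqrt 2 * s) x.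
Proof.
move=> s0 l0 lx.
have r2 : 0 < Num.sqrt 2 :> R by rewrite sqrtr_gt0.
have pE s1 : 0 < s1 -> normal_pdf 0 s1 x = normal_peak s1 * normal_fun 0 s1 x.
  by move=> s10; rewrite normal_pdfE// gt_eqF.
rewrite !pE ?mulr_gt0// /normal_fun subr0.
rewrite [(Num.sqrt 2 * s) ^+ 2]exprMn sqr_sqrtr//.
have s20 : 0 < s ^+ 2 by rewrite exprn_gt0.
set y := x ^+ 2 / (4 * s ^+ 2).
have -> : - x ^+ 2 / (s ^+ 2 *+ 2) = - y + - y.
  by rewrite /y; field; rewrite gt_eqF.
have -> : - x ^+ 2 / (2 * s ^+ 2 *+ 2) = - y.
  by rewrite /y; field; rewrite gt_eqF.
have lx2 : l ^+ 2 <= x ^+ 2.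
  by rewrite -(real_normK (num_real x)) lerXn2r ?nnegrE// ltW.
have l20 : 0 < l ^+ 2 by rewrite exprn_gt0.
pose z := l ^+ 2 / (4 * s ^+ 2).
have z0 : 0 < z by rewrite divr_gt0// mulr_gt0.
have zy : z <= y by rewrite /z /y ler_pM2r ?invr_gt0 ?mulr_gt0.
rewrite expRD.
have e1 : expR (- y) <= 64 * (s / l) ^+ 4.
  apply: (@le_trans _ _ (expR (- z))); first by rewrite ler_expR lerN2.
  apply: (le_trans (expR_le_sqr z0)).
  rewrite (_ : 4 / z ^+ 2 = 64 * (s / l) ^+ 4)//.
  by rewrite /z; field; rewrite !gt_eqF.
have p1 := normal_peak_le s0.
have p0 : 0 <= normal_peak s by exact: normal_peak_ge0.
rewrite (_ : 128 * _ * _ = (2 * normal_peak (Num.sqrt 2 * s)) *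
  (64 * (s / l) ^+ 4 * expR (- y))); last by ring.
apply: ler_pM => //.
by rewrite ler_pM2r ?expR_gt0.
Qed.

Lemma normal_tail s l : 0 < s -> 0 < l ->
  (normal_prob 0 s [set x | l <= `|x|]%R <= (128 * (s / l) ^+ 4)%:E)%E.
Proof.
move=> s0 l0; rewrite /normal_prob.
set A := [set x | _]; set K := 128 * _; set s' := Num.sqrt 2 * s.
have K0 : 0 <= K by rewrite mulr_ge0// exprn_ge0// divr_ge0// ltW.
have mA : measurable A by exact: (@measurable_norm_ge _ _ R id).
have m1 s1 : measurable_fun A (fun x => (normal_pdf 0 s1 x)%:E).
  by apply/measurable_EFinP/measurable_funTS; exact: measurable_normal_pdf.
have mK : measurable_fun setT (fun x => (K * normal_pdf 0 s' x)%:E).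
  apply/measurable_EFinP; apply: measurable_funM => //.
  exact: measurable_normal_pdf.
apply: (@le_trans _ _ (\int[lebesgue_measure]_(x in A) (K * normal_pdf 0 s' x)%:E)%E).
  apply: ge0_le_integral => //.
  - by move=> x _; rewrite lee_fin normal_pdf_ge0.
  - exact: m1.
  - exact: (measurable_funTS mK).
  - by move=> x Ax; rewrite lee_fin normal_pdf_tail.
apply: (@le_trans _ _ (\int[lebesgue_measure]_x (K * normal_pdf 0 s' x)%:E)%E).
  apply: ge0_subset_integral => //.
  by move=> x _; rewrite lee_fin mulr_ge0// normal_pdf_ge0.
under eq_integral do rewrite EFinM.
rewrite ge0_integralZl//.
- by rewrite integral_normal_pdf mule1.
- by apply/measurable_EFinP; exact: measurable_normal_pdf.
- by move=> x _; rewrite lee_fin normal_pdf_ge0.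
Qed.

End normal_tail.

Section chaining.
Context {R : realType}.

(** Increments at dyadic level [m] are allowed to be as large as [ratio ^ m].
Summability of the allowances needs [ratio < 1], and summability of the
exceptional probabilities needs [1 < 2 ratio^4], because the Gaussian tail is
used to the fourth power of a standard deviation [2^(- m / 2)]. *)
Definition ratio : R := 7 / 8.

(** The increments along the dyadic expansion of [t] add up to at most
[l / (1 - ratio) = 8 l]; the partial sums up to level [m] are
[8 l (1 - ratio ^ (m + 1))]. *)
Lemma dyadic_chaining (g : R -> R) (l : R) : 0 <= l -> continuous g ->
  (forall m k, (k < 2 ^ m)%N ->
     `|g (k.+1%:R / 2 ^+ m) - g (k%:R / 2 ^+ m)| <= l * ratio ^+ m) ->
  forall t, 0 <= t <= 1 -> `|g t - g 0| <= 8 * l.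
Proof.
move=> l0 cg H.
have q0 : 0 < ratio by rewrite /ratio divr_gt0.
have main m k : (k <= 2 ^ m)%N ->
    `|g (k%:R / 2 ^+ m) - g 0| <= 8 * l * (1 - ratio ^+ m.+1).
  elim: m k => [|m IH] k.
    rewrite expn0 expr0 divr1 expr1 => k1.
    have -> : 8 * l * (1 - ratio) = l by rewrite /ratio; field.
    case: k k1 => [|[|//]] _; first by rewrite subrr normr0.
    by have := H 0%N 0%N isT; rewrite !expr0 !divr1 mulr1.
  move=> km.
  have half j : (j.*2)%:R / 2 ^+ m.+1 = j%:R / 2 ^+ m :> R.
    by rewrite -muln2 natrM exprS; field; rewrite gt_eqF// exprn_gt0.
  have step : 8 * l * (1 - ratio ^+ m.+1) + l * ratio ^+ m.+1 =
      8 * l * (1 - ratio ^+ m.+2).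
    rewrite [ratio ^+ m.+2]exprS; move: (ratio ^+ m.+1) => X.
    by rewrite (_ : ratio = 7 / 8)//; field.
  have lq : 0 <= l * ratio ^+ m.+1 by rewrite mulr_ge0// exprn_ge0// ltW.
  have hk : (k./2 <= 2 ^ m)%N.
    rewrite -leq_double -(mul2n (2 ^ m)) -expnS (leq_trans _ km)//.
    by rewrite -{2}(odd_double_half k) leq_addl.
  have := odd_double_half k; move: (k./2) hk => j hj.
  case: (odd k) => kE; last first.
    by rewrite -kE add0n half (le_trans (IH _ hj))// -step lerDl.
  have jm : (j.*2 < 2 ^ m.+1)%N by rewrite (leq_trans _ km)// -kE.
  have -> : g (k%:R / 2 ^+ m.+1) - g 0 =
      (g (j%:R / 2 ^+ m) - g 0) +
      (g (j.*2.+1%:R / 2 ^+ m.+1) - g (j.*2%:R / 2 ^+ m.+1)).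
    by rewrite -kE add1n half [RHS]addrC subrKA.
  apply: (le_trans (ler_normD _ _)); rewrite -step.
  by apply: lerD; [exact: IH|exact: H].
move=> t t01; have cgt : continuous (fun t => `|g t - g 0|).
  by move=> s; apply: cvg_norm; apply: cvgB; [exact: cg|exact: cvg_cst].
apply: (dyadic_bound cgt _ t01) => m k km; apply: (le_trans (main _ _ km)).
by rewrite ler_piMr ?mulr_ge0// gerBl exprn_ge0// ltW.
Qed.

Lemma nneseries_le (e : nat -> R) (p : nat -> \bar R) (C : R) :
  (forall n, 0 <= p n)%E -> (forall n, (p n <= (e n)%:E)%E) ->
  (forall n, \sum_(0 <= i < n) e i <= C) ->
  (\sum_(0 <= i <oo) p i <= C%:E)%E.
Proof.
move=> p0 pe eC; apply: lime_le; first exact: is_cvg_nneseries.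
apply: nearW => n; apply: (@le_trans _ _ (\sum_(0 <= i < n) (e i)%:E)%E).
  exact: lee_sum.
by rewrite sumEFin lee_fin.
Qed.

Lemma geometric_sum_le (r : R) n : 0 <= r < 1 ->
  \sum_(0 <= i < n) r ^+ i <= (1 - r)^-1.
Proof.
move=> /andP[r0 r1]; have d0 : 0 < 1 - r by rewrite subr_gt0.
rewrite -[leRHS]mul1r ler_pdivlMr//.
have -> : (\sum_(0 <= i < n) r ^+ i) * (1 - r) = 1 - r ^+ n.
  elim: n => [|n IH]; first by rewrite big_nil mul0r expr0 subrr.
  by rewrite big_nat_recr//= mulrDl IH exprS; ring.
by rewrite gerBl exprn_ge0.
Qed.

(** Comparison with the telescoping sum of [2 (1 / (i + 1) - 1 / (i + 2))]. *)
Lemma inv4_sum_le n : \sum_(0 <= i < n) (i.+1%:R ^+ 4)^-1 <= 2 :> R.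
Proof.
suff : \sum_(0 <= i < n) (i.+1%:R ^+ 4)^-1 <= 2 * (1 - n.+1%:R^-1) :> R.
  by move/le_trans; apply; rewrite ler_piMr// gerBl invr_ge0.
elim: n => [|n IH]; first by rewrite big_nil invr1 subrr mulr0.
rewrite big_nat_recr//=.
apply: (@le_trans _ _ (2 * (1 - n.+1%:R^-1) + 2 * (n.+1%:R^-1 - n.+2%:R^-1)));
  last by rewrite -mulrDr addrA subrK.
apply: lerD => //.
have x0 : (0 : R) < n.+1%:R by [].
have x1 : (1 : R) <= n.+1%:R by rewrite ler1n.
rewrite -[n.+2%:R]natr1; move: (n.+1%:R) x0 x1 => x x0 x1.
have -> : 2 * (x^-1 - (x + 1)^-1) = 2 / (x * (x + 1)).
  by field; rewrite !gt_eqF// ltr_wpDr.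
have x3 : 1 <= x ^+ 3 by rewrite exprn_ege1.
rewrite ler_pdivlMr ?mulr_gt0 ?ltr_wpDr// mulrC ler_pdivrMr ?exprn_gt0//.
have : 1 * x <= x ^+ 3 * x by rewrite ler_pM2r.
rewrite -exprSr; have : x * x <= x ^+ 4.
  by rewrite (_ : x ^+ 4 = x * x * (x * x)); [rewrite ler_peMr//; nra|ring].
lra.
Qed.

End chaining.

(** * Almost sure growth of Brownian paths *)

Section borel_cantelli.
Context {R : realType}.

Lemma borel_cantelli d (T : measurableType d) (P : {measure set T -> \bar R})
    (F : nat -> set T) :
  (forall n, measurable (F n)) -> (\sum_(0 <= n <oo) P (F n) < +oo)%E ->
  {ae P, forall x, exists N, forall n, (N <= n)%N -> ~ F n x}.
Proof.
move=> mF Poo; exists (lim_sup_set F); split.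
- apply: bigcapT_measurable => n; apply: bigcup_measurable => k _; exact: mF.
- exact: lim_sup_set_cvg0.
- move=> x /= H n _; apply: contrapT => h; apply: H; exists n => k nk Fk.
  by apply: h; exists k.
Qed.

End borel_cantelli.

Section brownian_growth.
Context {R : realType} (P : probability (Omega R) R) (B : R -> Omega R -> R).
Hypothesis mB : forall t, measurable_fun [set: Omega R] (B t).
Hypothesis cB : forall w, continuous (fun t => B t w).
Hypothesis gB : gaussian_increments P B.

Definition large_increment (s t l : R) : set (Omega R) :=
  [set w | l <= `|B t w - B s w|].

Lemma measurable_large_increment s t l : measurable (large_increment s t l).
Proof. by apply: measurable_norm_ge; exact: measurable_funB. Qed.

Lemma large_increment_le (s t l : R) : s < t -> 0 < l ->
  (P (large_increment s t l) <= (128 * ((t - s) ^+ 2 / l ^+ 4))%:E)%E.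
Proof.
move=> st l0; have ts0 : 0 < t - s by rewrite subr_gt0.
have mA : measurable [set x : R | l <= `|x|].
  exact: (@measurable_norm_ge _ _ R id).
have -> := gB st mA.
apply: (le_trans (normal_tail _ l0)); first by rewrite sqrtr_gt0.
rewrite lee_fin expr_div_n [Num.sqrt _ ^+ 4](_ : _ = (Num.sqrt (t - s) ^+ 2) ^+ 2).
  by rewrite sqr_sqrtr// ltW.
by rewrite -exprM.
Qed.

(** The paths that violate the chaining condition on [[c, c + 1]] with the
allowance [N + 1], which is to be paired with intervals at distance of order
[N] from the origin. *)
Definition rough (c : R) (N : nat) : set (Omega R) :=
  \bigcup_m \big[setU/set0]_(k < 2 ^ m)
    large_increment (c + k%:R / 2 ^+ m) (c + k.+1%:R / 2 ^+ m)
      (N.+1%:R * ratio ^+ m).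

Lemma measurable_rough c N : measurable (rough c N).
Proof.
apply: bigcupT_measurable => m; apply: bigsetU_measurable => k _.
exact: measurable_large_increment.
Qed.

(** There are [2^m] increments of variance [2^(- m)] at level [m], so the
level contributes a constant times [(2 ratio^4)^(- m) / (N + 1)^4]. *)
Lemma rough_le c N : (P (rough c N) <= (128 * 9 * (N.+1%:R ^+ 4)^-1)%:E)%E.
Proof.
pose r : R := (2 * ratio ^+ 4)^-1.
have q0 : 0 < ratio :> R by rewrite divr_gt0.
have r0 : 0 <= r by rewrite invr_ge0 mulr_ge0// exprn_ge0// ltW.
have q2 : 3 / 4 <= ratio ^+ 2 :> R by rewrite /ratio expr2; lra.
have q4 : 9 / 8 <= 2 * ratio ^+ 4 :> R.
  have : (3 / 4) ^+ 2 <= (ratio ^+ 2) ^+ 2 :> R.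
    by rewrite lerXn2r ?nnegrE ?exprn_ge0 ?(ltW q0) ?divr_ge0.
  by rewrite -exprM [(3 / 4) ^+ 2]expr2; lra.
have r89 : r <= 8 / 9.
  have q40 : 0 < 2 * ratio ^+ 4 :> R by apply: lt_le_trans q4; lra.
  have h0 : 0 < 9 / 8 :> R by lra.
  by rewrite /r -[leRHS]invrK invf_div lef_pV2 ?posrE.
have r1 : 0 <= r < 1 by rewrite r0/=; lra.
pose c4 : R := 128 * (N.+1%:R ^+ 4)^-1.
have c40 : 0 <= c4 by rewrite mulr_ge0// invr_ge0 exprn_ge0.
apply: (@le_trans _ _ (\sum_(0 <= m <oo)
  P (\big[setU/set0]_(k < 2 ^ m)
    large_increment (c + k%:R / 2 ^+ m) (c + k.+1%:R / 2 ^+ m)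
      (N.+1%:R * ratio ^+ m)))%E).
  apply: measure_sigma_subadditive => //.
  - by move=> m; apply: bigsetU_measurable => k _; exact: measurable_large_increment.
  - exact: measurable_rough.
apply: (nneseries_le (e := fun m => c4 * r ^+ m)) => [m|m|n].
- exact: measure_ge0.
- have p0 : (0 : R) < 2 ^+ m by rewrite exprn_gt0.
  have qm0 : 0 < ratio ^+ m :> R by rewrite exprn_gt0.
  have N0 : (0 : R) < N.+1%:R by [].
  pose F k := large_increment (c + k%:R / 2 ^+ m) (c + k.+1%:R / 2 ^+ m)
    (N.+1%:R * ratio ^+ m).
  have mF k : (k < 2 ^ m)%N -> measurable (F k).
    by move=> _; exact: measurable_large_increment.
  apply: (le_trans (le_mu_bigsetU P mF)).
  apply: (@le_trans _ _ (\sum_(k < 2 ^ m)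
      (128 * ((2 ^+ m)^-1 ^+ 2 / (N.+1%:R * ratio ^+ m) ^+ 4))%:E)%E).
    apply: lee_sum => k _.
    have e : c + k.+1%:R / 2 ^+ m - (c + k%:R / 2 ^+ m) = (2 ^+ m)^-1 :> R.
      by rewrite -natr1; field; rewrite gt_eqF.
    rewrite -e; apply: large_increment_le; last by rewrite mulr_gt0.
    by rewrite -subr_gt0 e invr_gt0.
  rewrite sumEFin lee_fin sumr_const card_ord -[leLHS]mulr_natl natrX.
  have -> : r ^+ m = (2 ^+ m * (ratio ^+ m) ^+ 4)^-1.
    by rewrite /r exprVn exprMn exprAC.
  rewrite /c4; move: (2 ^+ m) (ratio ^+ m) (N.+1%:R) p0 qm0 N0 => x q y x0 qq0 y0.
  by rewrite le_eqVlt; apply/orP; left; apply/eqP; field; rewrite !gt_eqF.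
- rewrite -mulr_sumr.
  have h := geometric_sum_le n r1.
  apply: (@le_trans _ _ (c4 * (1 - r)^-1)); first by rewrite ler_wpM2l.
  rewrite /c4 mulrAC ler_wpM2r ?invr_ge0 ?exprn_ge0// ler_wpM2l//.
  by rewrite -[leRHS]invrK lef_pV2 ?posrE ?invr_gt0//; lra.
Qed.

Lemma increments_linear_growth (c : nat -> R) :
  {ae P, forall w, exists N0 : nat, forall N t, (N0 <= N)%N -> 0 <= t <= 1 ->
    `|B (c N + t) w - B (c N) w| <= 8 * N.+1%:R}.
Proof.
have bc := @borel_cantelli R _ _ P (fun N => rough (c N) N)
  (fun N => measurable_rough (c N) N).
have Poo : (\sum_(0 <= N <oo) P (rough (c N) N) < +oo)%E.
  apply: (@le_lt_trans _ _ (128 * 9 * 2 : R)%:E); last exact: ltry.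
  apply: (nneseries_le (e := fun N => 128 * 9 * (N.+1%:R ^+ 4)^-1)) => [N|N|n].
  - exact: measure_ge0.
  - exact: rough_le.
  - by rewrite -mulr_sumr ler_pM2l// inv4_sum_le.
have := bc Poo; apply: filterS => w [N0 hN0]; exists N0 => N t NN t01.
have := hN0 N NN; move=> nr.
pose g s := B (c N + s) w.
have cg : continuous g.
  move=> s; apply: (@continuous_comp _ _ _ (fun s : R => c N + s) (fun t => B t w)).
    by apply: cvgD; [exact: cvg_cst|exact: cvg_id].
  exact: cB.
have -> : B (c N) w = g 0 by rewrite /g addr0.
apply: (dyadic_chaining (l := N.+1%:R) _ cg _ t01) => // m k km.
rewrite leNgt; apply/negP => h; apply: nr.
exists m => //; rewrite /= -(bigcup_mkord (2 ^ m) (fun k => large_increment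
  (c N + k%:R / 2 ^+ m) (c N + k.+1%:R / 2 ^+ m) (N.+1%:R * ratio ^+ m))).
exists k => //.
exact: ltW.
Qed.

End brownian_growth.

(** * Temperedness *)

Section growth.
Context {R : realType}.
Implicit Types (w : Omega R).

(** The window [[t - 1, t]] is covered by the two unit intervals that start at
[c] and at [c + 1]. *)
Lemma osc_theta_le w (t c M : R) : c <= t - 1 <= c + 1 ->
  (forall u, 0 <= u <= 1 -> `|bpath w (c + u) - bpath w c| <= M) ->
  (forall u, 0 <= u <= 1 -> `|bpath w (c + 1 + u) - bpath w (c + 1)| <= M) ->
  osc (theta t w) <= 4 * M.
Proof.
move=> /andP[c1 c2] H1 H2.
have M0 : 0 <= M by apply: le_trans (H1 0 _); rewrite ?normr_ge0// lexx ler01.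
have H r : c <= r <= c + 2 -> `|bpath w r - bpath w c| <= 2 * M.
  move=> /andP[cr rc]; have [r1|r1] := leP r (c + 1).
    rewrite (_ : r = c + (r - c)); last by rewrite addrC subrK.
    by apply: (le_trans (H1 _ _)); [apply/andP; split; lra|rewrite ler_peMl// ler1n].
  rewrite -(subrKA (bpath w (c + 1))) (_ : 2 * M = M + M); last by ring.
  apply: (le_trans (ler_normD _ _)); apply: lerD; last by apply: H1; rewrite lexx ler01.
  rewrite {1}(_ : r = c + 1 + (r - (c + 1))); last by rewrite addrC subrK.
  by apply: H2; apply/andP; split; lra.
apply: osc_le => s /andP[s1 s2]; rewrite !thetaE opprB addrA subrK.
rewrite -(subrKA (bpath w c)) (_ : 4 * M = 2 * M + 2 * M); last by ring.
apply: (le_trans (ler_normD _ _)); apply: lerD.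
  by apply: H; apply/andP; split; lra.
by rewrite distrC; apply: H; apply/andP; split; lra.
Qed.

Lemma path_linear_growth (P : probability (Omega R) R) (c : nat -> R) :
  wiener_measure P ->
  {ae P, forall w, exists N0 : nat, forall N t, (N0 <= N)%N -> 0 <= t <= 1 ->
    `|bpath w (c N + t) - bpath w (c N)| <= 8 * N.+1%:R}.
Proof.
move=> [[m1 c1 g1 _] [m2 c2 g2 _] _].
have h1 := increments_linear_growth m1 (fun w => (c1 w).2) g1 c.
have h2 := increments_linear_growth m2 (fun w => (c2 w).2) g2 c.
apply: filterS2 h1 h2 => w [N1 h1] [N2 h2]; exists (maxn N1 N2) => N t.
rewrite geq_max => /andP[NN1 NN2] t01.
by rewrite norm_pair_le; apply/andP; split; [exact: h1|exact: h2].
Qed.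

(** The almost sure bounds on the intervals that start at [N] and at [- N]
cover both time directions. *)
Lemma osc_linear_growth (P : probability (Omega R) R) : wiener_measure P ->
  {ae P, forall w, exists T0 : R, forall t, T0 <= `|t| ->
    osc (theta t w) <= 64 * `|t|}.
Proof.
move=> wP.
have h1 := path_linear_growth (fun N => N%:R) wP.
have h2 := path_linear_growth (fun N => - N%:R) wP.
apply: filterS2 h1 h2 => w [N1 h1] [N2 h2].
exists (N1%:R + N2%:R + 3) => t.
have n1 : (0 : R) <= N1%:R by []. have n2 : (0 : R) <= N2%:R by [].
have [t0|t0] := leP 0 t; rewrite ?(ger0_norm t0) ?(ltr0_norm t0) => Tt.
- have t1 : 0 <= t - 1 by lra.
  have /andP[k1 k2] := truncn_itv t1; set N := Num.trunc _ in k1 k2.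
  have NN : (N1 <= N)%N by rewrite -ltnS -(ltr_nat R); lra.
  rewrite -natr1 in k2.
  apply: (@le_trans _ _ (4 * (8 * (N%:R + 2)))); last by lra.
  apply: (@osc_theta_le w t N%:R).
  + by rewrite k1 ltW.
  + by move=> u /(h1 N u NN) h; apply: (le_trans h); rewrite -natr1; lra.
  + move=> u /(h1 N.+1 u (leqW NN)); rewrite -!natr1 => h.
    by apply: (le_trans h); lra.
- have t1 : 0 <= 1 - t by lra.
  have /andP[k1 k2] := truncn_itv t1; set N := Num.trunc _ in k1 k2.
  have NN : (N2 <= N)%N by rewrite -ltnS -(ltr_nat R); lra.
  rewrite -natr1 in k2.
  apply: (@le_trans _ _ (4 * (8 * (N%:R + 2)))); last by lra.
  (* Here [N] is the integer part of [1 - t], and the window lies in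
     [[- (N + 1), - (N - 1)]]. *)
  have cE : - N.+1%:R + 1 = - N%:R :> R by rewrite -natr1; ring.
  apply: (@osc_theta_le w t (- N.+1%:R)).
  + by rewrite cE -natr1; apply/andP; split; lra.
  + move=> u /(h2 N.+1 u (leqW NN)); rewrite -!natr1 => h.
    by apply: (le_trans h); lra.
  + by rewrite cE => u /(h2 N u NN) h; apply: (le_trans h); rewrite -natr1; lra.
Qed.

Lemma ln_le_sqrt (x : R) : 1 <= x -> ln x <= 2 * Num.sqrt x.
Proof.
move=> x1; have x0 : 0 < x by rewrite (lt_le_trans ltr01).
have s0 : 0 < Num.sqrt x by rewrite sqrtr_gt0.
rewrite -{1}(sqr_sqrtr (ltW x0)) lnXn// -[leLHS]mulr_natl ler_pM2l//.
have := @le_ln1Dx R (Num.sqrt x - 1); rewrite [1 + _]addrC subrK => h.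
by apply: (le_trans (h _)); lra.
Qed.

(** The square root is negligible with respect to [x]; it comes from
[ln x = 2 ln (sqrt x)]. *)
Lemma lnplus_le (K x y : R) : 1 <= K -> 1 <= x -> y <= K * x ^+ 4 ->
  lnplus y <= (K + 8) * Num.sqrt x.
Proof.
move=> K1 x1 yK; have x0 : 0 < x by rewrite (lt_le_trans ltr01).
have K0 : 0 < K by rewrite (lt_le_trans ltr01).
have sx1 : 1 <= Num.sqrt x by rewrite -{1}(sqrtr1 R) ler_sqrt // ltW.
rewrite /lnplus ge_max mulr_ge0 ?sqrtr_ge0 ?addr_ge0 ?(ltW K0)//=.
have [y0|y0] := leP y 0.
  by rewrite ln0// mulr_ge0 ?sqrtr_ge0 ?addr_ge0 ?(ltW K0).
have x40 : 0 < x ^+ 4 by rewrite exprn_gt0.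
apply: (@le_trans _ _ (ln (K * x ^+ 4))).
  by rewrite ler_ln ?posrE ?mulr_gt0.
rewrite lnM ?posrE// lnXn// mulrDl; apply: lerD.
  apply: (@le_trans _ _ K); last by rewrite ler_peMr// ltW.
  have := @le_ln1Dx R (K - 1); rewrite [1 + _]addrC subrK => h.
  by apply: (le_trans (h _)); lra.
by have := ln_le_sqrt x1; rewrite -[ln x *+ 4]mulr_natl; lra.
Qed.

Lemma cvg_sqrt_over (C T0 : R) (f : R -> R) : 0 <= C ->
  (forall t, T0 <= `|t| -> 0 <= f t <= C * Num.sqrt `|t|) ->
  (f t / `|t| @[t --> +oo] --> (0 : R)) /\ (f t / `|t| @[t --> -oo] --> (0 : R)).
Proof.
move=> C0 H.
have key e t : 0 < e -> Num.max T0 (Num.max 1 ((C / e) ^+ 2)) <= `|t| ->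
    `|0 - f t / `|t| | <= e.
  move=> e0; rewrite !ge_max => /andP[tT /andP[t1 tC]].
  have t0 : 0 < `|t| by rewrite (lt_le_trans ltr01).
  have /andP[f0 fC] := H _ tT.
  rewrite sub0r normrN ger0_norm ?divr_ge0// ler_pdivrMr//.
  apply: (le_trans fC); rewrite -{2}(sqr_sqrtr (ltW t0)) expr2 mulrA.
  rewrite ler_wpM2r ?sqrtr_ge0// mulrC -ler_pdivrMr//.
  rewrite -[leLHS]ger0_norm ?divr_ge0 ?(ltW e0)// -sqrtr_sqr ler_sqrt//.
split; apply/cvgrPdist_le => e e0.
  near=> t; apply: key => //; apply: le_trans (ler_norm t).
  by near: t; apply: nbhs_pinfty_ge; exact: num_real.
near=> t; apply: key => //; rewrite -normrN; apply: le_trans (ler_norm (- t)).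
by rewrite lerNr; near: t; apply: nbhs_ninfty_le; exact: num_real.
Unshelve. all: by end_near.
Qed.

End growth.

Section tempered.
Context {R : realType}.
Variables (alpha beta a b sigma : R).
Hypothesis a_gt0 : 0 < a.

Local Notation rad := (radius alpha beta a b sigma).

(** The radius is a polynomial of degree four in the oscillation. *)
Lemma radius_le : exists2 K, 1 <= K &
  forall S x : R, 0 <= S <= 64 * x -> 1 <= x -> 2 * rad S + 1 <= K * x ^+ 4.
Proof.
rewrite /radius /damping_const.
have l0 := lin_ge0 alpha beta; have k0 := young_ge0 b a_gt0.
set A := _ ^+ 2 / a; set L := lin_const _ _; set D := _ / a + a / 2.
have A0 : 0 <= A by rewrite divr_ge0 ?sqr_ge0// ltW.
have D0 : 0 <= D by rewrite addr_ge0// divr_ge0 ?sqr_ge0// ltW.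
have a0 : 0 <= 16 / a by rewrite divr_ge0// ltW.
(* [E x^2] bounds the noise when the oscillation is at most [64 x]. *)
pose E := 2 * (`|sigma| * 64) ^+ 2.
have E0 : 0 <= E by rewrite mulr_ge0 ?sqr_ge0.
exists (2 * (2 * (16 / a + (A + L * E + D * E ^+ 2)) + 2 * E + 1) + 1).
  rewrite lerDr mulr_ge0// addr_ge0// addr_ge0// mulr_ge0//.
  by rewrite !addr_ge0// ?mulr_ge0// ?sqr_ge0.
move=> S x /andP[S0 Sx] x1.
have x0 : 0 <= x by rewrite (le_trans ler01).
have nS : noise_bound sigma S <= E * x ^+ 2.
  rewrite /noise_bound /E -mulrA ler_pM2l// -exprMn lerXn2r ?nnegrE ?mulr_ge0//.
  by rewrite -mulrA ler_wpM2l.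
have n0 : 0 <= noise_bound sigma S by rewrite mulr_ge0 ?sqr_ge0.
have n2 : noise_bound sigma S ^+ 2 <= E ^+ 2 * x ^+ 4.
  have -> : x ^+ 4 = (x ^+ 2) ^+ 2 by rewrite -exprM.
  by rewrite -exprMn lerXn2r ?nnegrE// mulr_ge0 ?sqr_ge0.
have x4 : 1 <= x ^+ 4 by rewrite exprn_ege1.
have x24 : x ^+ 2 <= x ^+ 4 by rewrite ler_weXn2l.
have n1 : noise_bound sigma S <= E * x ^+ 4 by rewrite (le_trans nS)// ler_wpM2l.
move: (noise_bound sigma S) (x ^+ 4) n0 n1 n2 x4 => U X U0 U1 U2 X1.
have p1 : L * U <= L * (E * X) by rewrite ler_wpM2l.
have p2 : D * U ^+ 2 <= D * (E ^+ 2 * X) by rewrite ler_wpM2l.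
have p3 : 16 / a <= 16 / a * X by rewrite ler_peMr.
have p4 : A <= A * X by rewrite ler_peMr.
lra.
Qed.

Lemma attractor_tempered (P : probability (Omega R) R) : wiener_measure P ->
  tempered_set P (attractor alpha beta a b sigma).
Proof.
move=> wP; exists (fun w => 2 * rad (osc w) + 1); split; last first.
  apply: aeW => w x /(attractor_bound a_gt0) xr; rewrite /eball/=.
  by apply: (lt_le_trans (enorm_lt x)); rewrite lerD2r ler_pM2l.
split.
  have mo := @measurable_osc R.
  have mn : measurable_fun setT (fun w : Omega R => noise_bound sigma (osc w)).
    apply: measurable_funM => //; apply: measurable_funX; exact: measurable_funM.
  apply: measurable_funD => //; apply: measurable_funM => //.
  apply: measurable_funD => //; apply: measurable_funD; last exact: measurable_funM.
  apply: measurable_funM => //; apply: measurable_funD => //.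
  apply: measurable_funD; last by apply: measurable_funM => //; exact: measurable_funX.
  by apply: measurable_funD => //; exact: measurable_funM.
have [K K1 hK] := radius_le.
apply: filterS (osc_linear_growth wP) => w [T0 hT].
apply: (@cvg_sqrt_over _ (K + 8) (Num.max T0 1)).
  by rewrite addr_ge0// (le_trans ler01).
move=> t; rewrite ge_max => /andP[tT t1]; apply/andP; split.
  by rewrite /lnplus le_max lexx.
by apply: lnplus_le => //; apply: hK => //; rewrite osc_ge0 hT.
Qed.

Lemma attractor_random_attractor (P : probability (Omega R) R) : wiener_measure P ->
  random_attractor P (flow alpha beta a b sigma) (attractor alpha beta a b sigma).
Proof.
move=> wP; split.
- split; [exact: measurable_attractor|exact: attractor_tempered|].
  by apply: aeW => w; exact: attractor_compact.
- by apply: aeW => w t t0; exact: attractor_invariant.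
- move=> D _; apply: aeW => w; apply: cvge_to_0 => e e0.
  have e2 : 0 < e / 2 by rewrite divr_gt0.
  have [N hN] := @attractor_attracts _ alpha beta a b sigma a_gt0 w _ e2.
  near=> t.
  have -> : e = 2 * (e / 2) by field.
  apply: semi_dist_le; first exact: ltW.
  move=> _ [Z _ <-]; apply: hN.
  by near: t; apply: nbhs_pinfty_ge; exact: num_real.
Unshelve. all: by end_near.
Qed.

End tempered.

Theorem theoremA (R : realType) (alpha beta a b sigma : R)
    (a_gt0 : 0 < a) (sigma_ge0 : 0 <= sigma)
    (P : probability (Omega R) R) (wienerP : wiener_measure P) :
  exists Oh : set (Omega R),
    [/\ measurable Oh,
        forall t : R, theta t @^-1` Oh = Oh,
        P Oh = 1%E
      & exists phi : R -> Omega R -> R * R -> R * R,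
          [/\ forall w Z, Oh w -> forall T : R, 0 <= T ->
                is_solution (drift alpha beta a b) sigma w Z T
                  (fun t => phi t w Z),
              forall w Z, Oh w -> forall (T : R) psi, 0 <= T ->
                is_solution (drift alpha beta a b) sigma w Z T psi ->
                forall t : R, 0 <= t <= T -> psi t = phi t w Z,
              random_dynamical_system Oh phi
            & exists A : set (Omega R * (R * R)),
                random_attractor P phi A /\
                measurable_multifunction (past 0) (xsection A)]].
Proof.
exists setT; split.
- exact: measurableT.
- by move=> t; rewrite preimage_setT.
- exact: probability_setT.
- exists (flow alpha beta a b sigma); split.
  + by move=> w Z _ T T0; exact: flow_solution.
  + by move=> w Z _ T psi T0 s t tT; exact: (flow_unique a_gt0 T0 s).
  + exact: flow_rds.
  + exists (attractor alpha beta a b sigma); split.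
      exact: attractor_random_attractor.
    exact: attractor_past.
Qed.
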